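(* Let $\mathcal{H}$ be a real Hilbert space with inner product $\langle\cdot,\cdot\rangle$ and norm $\|\cdot\|$. Let $\Phi:\mathcal{H}\to\mathbb{R}$ be a convex $C^1$ function such that $\arg\min\Phi=\{v\in\mathcal{H}:\Phi(v)=\Phi^*\}$ is nonempty, where $\Phi^*=\min_{x\in\mathcal{H}}\Phi(x)$. Let $c>0$, $\alpha\in[0,1)$, $\gamma(t)=\frac{c}{(1+t)^\alpha}$, and $g\in L^1(0,+\infty;\mathcal{H})$. Let $x\in W^{2,1}_{loc}(0,+\infty;\mathcal{H})$ be a solution of $$\ddot x(t)+\gamma(t)\dot x(t)+\nabla\Phi(x(t))=g(t),\quad t\ge 0,$$ and let $W(t)=\frac12\|\dot x(t)\|^2+\Phi(x(t))-\Phi^*$. Let $\nu\in[\alpha,\frac{1+\alpha}{2}]$ and assume that $\int_0^{+\infty}(1+t)^\nu\|g(t)\|\,dt<\infty$. Then $W(t)=o\left(\frac{1}{t^{2\nu}}\right)$ as $t\to+\infty$, and $\int_0^{+\infty}(1+t)^{2\nu-\alpha}\|\dot x(t)\|^2\,dt<\infty$.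
   Context: $W^{2,1}_{loc}(0,+\infty;\mathcal{H})$ denotes functions whose first and second (weak) derivatives are locally integrable with values in $\mathcal{H}$; $\dot x,\ddot x$ denote the first and second time derivatives. *)

(* Defs.v *)
From HB Require Import structures.
From mathcomp Require Import all_boot all_order all_algebra.
From mathcomp Require Import all_classical all_reals all_analysis.
Set Implicit Arguments. Unset Strict Implicit. Unset Printing Implicit Defensive.
Import Order.TTheory GRing.Theory Num.Theory.
Import numFieldNormedType.Exports.
Local Open Scope classical_set_scope.
Local Open Scope ring_scope.

(* A real Hilbert space: a complete normed R-module [H] whose norm comes from
   the inner product [ip] (symmetric, bilinear, ||v||^2 = <v,v>). *)
Definition is_inner_product (R : realType) (H : normedModType R)
    (ip : H -> H -> R) : Prop :=
  [/\ forall u v, ip u v = ip v u,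
      forall a u v w, ip (a *: u + v) w = a * ip u w + ip v w
    & forall v, `|v| ^+ 2 = ip v v].

Definition convex_on_space (R : realType) (H : normedModType R)
    (Phi : H -> R) : Prop :=
  forall (u v : H) (l : R), 0 <= l <= 1 ->
    Phi (l *: u + (1 - l) *: v) <= l * Phi u + (1 - l) * Phi v.

Definition is_C1_gradient (R : realType) (H : normedModType R)
    (ip : H -> H -> R) (Phi : H -> R) (gradPhi : H -> H) : Prop :=
  (forall v : H, differentiable Phi v /\
     forall h : H, 'd Phi v h = ip (gradPhi v) h)
  /\ continuous gradPhi.

Definition abs_continuous_on (R : realType) (H : normedModType R)
    (a b : R) (f : R -> H) : Prop :=
  forall e : R, 0 < e -> exists2 d : R, 0 < d &
    forall (n : nat) (s t : 'I_n -> R),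
      (forall i, a <= s i /\ s i <= t i /\ t i <= b) ->
      (forall i j, i != j -> t i <= s j \/ t j <= s i) ->
      \sum_(i < n) (t i - s i) < d ->
      \sum_(i < n) `|f (t i) - f (s i)| < e.

(* Main.v *)
(* With s = 1 + t, h = |x - xstar|^2 / 2 and K = 2 nu + 1, put
     E = s^(2 nu) W + K (s^(2 nu - 1) h' + c s^(2 nu - 1 - alpha) h).
   The last term of E cancels the damping in the derivative of the previous one,
   and convexity bounds <grad Phi (x), x - xstar> below by Phi (x) - min Phi.
   Since K exceeds 2 nu by 1, the derivative of E is at most
     - s^(2 nu - 1) W - (c / 2) s^(2 nu - alpha) |x'|^2 + psi (1 + E)
   for large t, where psi is a combination of s^nu |g| and of s^(alpha / 2 - 3 / 2),
   hence integrable.  By Gronwall E is bounded and both dissipation terms are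
   integrable.  Finally F = s^(2 nu) W has F' <= 2 nu F / s + C s^nu |g| with an
   integrable right-hand side, so F is nearly nonincreasing at infinity, while
   the integrability of F / s makes F small at arbitrarily large times. *)

Require Import Defs.
From HB Require Import structures.
From mathcomp Require Import all_boot all_order all_algebra.
From mathcomp Require Import all_classical all_reals all_analysis.
From mathcomp Require Import measurable_realfun ring lra.
Import Order.TTheory GRing.Theory Num.Theory.
Import numFieldNormedType.Exports.
Local Open Scope classical_set_scope.
Local Open Scope ring_scope.

Set Implicit Arguments. Unset Strict Implicit.

(** * Absolutely continuous functions *)

(** The equation holds only almost everywhere and [xd] is merely absolutely continuous, so a
    pointwise bound on a derivative gives nothing by itself. Each differential inequality is
    rewritten as a nonpositive a.e. derivative of an absolutely continuous function, into which the
    integrals of the other terms enter as primitives; one monotonicity lemma then replaces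
    integration. The weights are tied together by s^(2 nu - 1) = p w th, where p^2 and w^2 are the
    weights of W and of h in E, and th^2 = s^(alpha - 1). Since alpha < 1, th tends to 0, so K th^2
    <= c / 4 from some time on. This one smallness condition makes E nonnegative despite its cross
    term and lets the damping absorb the kinetic terms of the wrong sign. The remainder th / s is
    the power s^(alpha / 2 - 3 / 2). The bound nu <= (1 + alpha) / 2 says that w is nonincreasing,
    so the derivative of the weight of h has the favourable sign. *)

Section absolute_continuity.
Context {R : realType}.
Implicit Types (a b : R).
Notation mu := (@lebesgue_measure R).

(** Reduces closure under sums, products, inner products and exponentials to one estimate of
    increments; with a single controlling function, the other is repeated or constant. *)
Lemma abs_continuous_on_le (H1 H2 H3 : normedModType R) a b (u : R -> H1)
    (v : R -> H2) (f : R -> H3) (L : R) :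
  abs_continuous_on a b u -> abs_continuous_on a b v ->
  (forall s t, a <= s -> s <= t -> t <= b ->
    `|f t - f s| <= L * (`|u t - u s| + `|v t - v s|)) ->
  abs_continuous_on a b f.
Proof.
move=> acu acv fuv e e0.
have L0 : 0 < `|L| + 1 by rewrite ltr_wpDl.
have e'0 : 0 < e / (`|L| + 1) / 2 by rewrite !divr_gt0.
have [d1 d10 ud1] := acu _ e'0; have [d2 d20 vd2] := acv _ e'0.
exists (Num.min d1 d2); first by rewrite lt_min d10.
move=> n s t st dst; rewrite lt_min => /andP[sd1 sd2].
have us := ud1 n s t st dst sd1; have vs := vd2 n s t st dst sd2.
apply: (@le_lt_trans _ _ (\sum_(i < n) (`|L| + 1) *
    (`|u (t i) - u (s i)| + `|v (t i) - v (s i)|))).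
  apply: ler_sum => i _; have [ai [sti bi]] := st i.
  apply: (le_trans (fuv _ _ ai sti bi)).
  rewrite ler_wpM2r ?addr_ge0//.
  by rewrite (le_trans (ler_norm _))// lerDl.
rewrite -mulr_sumr big_split/= mulrC -ltr_pdivlMr//.
by rewrite [ltRHS]splitr ltrD.
Qed.

Lemma abs_continuous_onD (H : normedModType R) a b (u v : R -> H) :
  abs_continuous_on a b u -> abs_continuous_on a b v ->
  abs_continuous_on a b (fun t => u t + v t).
Proof.
move=> acu acv; apply: (abs_continuous_on_le (L := 1) acu acv) => s t _ _ _.
by rewrite mul1r opprD addrACA ler_normD.
Qed.

Lemma lipschitz_abs_continuous_on (H : normedModType R) a b (f : R -> H) (L : R) :
  (forall s t, a <= s -> s <= t -> t <= b -> `|f t - f s| <= L * (t - s)) ->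
  abs_continuous_on a b f.
Proof.
move=> fL; have acid : abs_continuous_on a b (fun t : R => t : R).
  move=> e e0; exists e => // n s t st _.
  rewrite (eq_bigr (fun i => `|t i - s i|)) // => i _.
  by rewrite ger0_norm// subr_ge0; have [_ []] := st i.
have L2 s t : a <= s -> s <= t -> t <= b ->
    `|f t - f s| <= L / 2 * (`|t - s| + `|t - s|).
  move=> a_s st tb; rewrite ger0_norm ?subr_ge0//.
  by apply: le_trans (fL _ _ a_s st tb) _; lra.
exact: (abs_continuous_on_le acid acid L2).
Qed.

Lemma abs_continuous_on_cst (H : normedModType R) a b (k : H) :
  abs_continuous_on a b (fun=> k).
Proof.
apply: (@lipschitz_abs_continuous_on _ _ _ _ 0) => s t _ _ _.
by rewrite subrr normr0 mul0r.
Qed.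

Lemma abs_continuous_on_sub (H : normedModType R) a b a' b' (f : R -> H) :
  a <= a' -> b' <= b -> abs_continuous_on a b f -> abs_continuous_on a' b' f.
Proof.
move=> aa' bb' acf e e0; have [d d0 fd] := acf _ e0; exists d => // n s t st.
apply: fd => i; have [ai [-> bi]] := st i.
by rewrite (le_trans aa')// (le_trans _ bb').
Qed.

Lemma abs_continuous_on_dist (H : normedModType R) a b (f : R -> H) :
  abs_continuous_on a b f -> forall e, 0 < e -> exists2 d : R, 0 < d &
    forall s t, a <= s <= b -> a <= t <= b -> `|t - s| < d -> `|f t - f s| < e.
Proof.
move=> acf e e0; have [d d0 fd] := acf _ e0; exists d => // s t.
wlog st : s t / s <= t => [wlg|].
  have [st|/ltW ts] := leP s t; first exact: wlg.
  by move=> sab tab; rewrite distrC [X in _ -> X < _]distrC; exact: wlg.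
move=> /andP[sa sb] /andP[ta tb]; rewrite ger0_norm ?subr_ge0// => std.
have := fd 1%N (fun=> s) (fun=> t); rewrite !big_ord1; apply => //.
by move=> i j; rewrite !ord1 eqxx.
Qed.

Lemma abs_continuous_on_within (H : normedModType R) a b (f : R -> H) :
  abs_continuous_on a b f -> {within `[a, b], continuous f}.
Proof.
move=> acf; apply/subspace_continuousP => t /=; rewrite in_itv/= => tab.
apply/cvgrPdist_lt => e e0; have [d d0 fd] := abs_continuous_on_dist acf e0.
rewrite near_withinE; apply/nbhs_ballP; exists d => //= s; rewrite /ball/= => ts.
by rewrite in_itv/= => sab; exact: fd.
Qed.

Lemma abs_continuous_on_continuous (H : normedModType R) a b (f : R -> H) t :
  abs_continuous_on a b f -> a < t < b -> {for t, continuous f}.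
Proof.
move=> acf tab; have : {within `]a, b[, continuous f}.
  apply: continuous_subspaceW (abs_continuous_on_within acf).
  exact: subset_itv_oo_cc.
by rewrite continuous_open_subspace// => fc; apply: fc; rewrite inE/= in_itv.
Qed.

Lemma abs_continuous_on_bounded (H : normedModType R) a b (f : R -> H) :
  abs_continuous_on a b f -> exists2 M, 0 < M & forall t, a <= t <= b -> `|f t| <= M.
Proof.
move=> acf; have [|ba] := leP a b; last first.
  by exists 1 => // t /andP[/le_trans ta /ta]; rewrite leNgt ba.
move=> ab.
have : {within `[a, b], continuous (fun t => `|f t|)}.
  move=> t; apply: continuous_comp; first exact: (abs_continuous_on_within acf).
  exact: norm_continuous.
move=> /(EVT_max ab)[c _ fc]; exists (`|f c| + 1); first by rewrite ltr_wpDl.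
by move=> t tab; rewrite (@le_trans _ _ `|f c|) ?lerDl// fc// in_itv.
Qed.

Lemma abs_continuous_onM a b (u v : R -> R) :
  abs_continuous_on a b u -> abs_continuous_on a b v ->
  abs_continuous_on a b (fun t => u t * v t).
Proof.
move=> acu acv; have [M M0 uM] := abs_continuous_on_bounded acu.
have [N N0 vN] := abs_continuous_on_bounded acv.
apply: (abs_continuous_on_le (L := M + N) acu acv) => s t a_s st tb.
have -> : u t * v t - u s * v s = (u t - u s) * v t + u s * (v t - v s) by ring.
have vt : `|v t| <= N by apply: vN; rewrite tb andbT (le_trans a_s).
have us : `|u s| <= M by apply: uM; rewrite a_s (le_trans st).
apply: (le_trans (ler_normD _ _)); rewrite !normrM.
have := normr_ge0 (u t - u s); have := normr_ge0 (v t - v s).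
have := normr_ge0 (v t); have := normr_ge0 (u s).
nra.
Qed.

Lemma abs_continuous_onZ a b (k : R) (u : R -> R) :
  abs_continuous_on a b u -> abs_continuous_on a b (fun t => k * u t).
Proof. by apply: abs_continuous_onM; exact: abs_continuous_on_cst. Qed.

(** Lists ordered from left to right suit an induction that appends one interval at a time. *)
Lemma abs_continuous_on_seq (H : normedModType R) a b (f : R -> H) :
  abs_continuous_on a b f -> forall e, 0 < e -> exists2 d : R, 0 < d &
    forall l : seq (R * R), all (fun p => [&& a <= p.1, p.1 <= p.2 & p.2 <= b]) l ->
      pairwise (fun p q => p.2 <= q.1) l ->
      \sum_(p <- l) (p.2 - p.1) < d -> \sum_(p <- l) `|f p.2 - f p.1| < e.
Proof.
move=> acf e e0; have [d d0 fd] := acf _ e0; exists d => // l /allP lab pl.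
rewrite !(big_nth (0, 0)) !big_mkord => ld.
apply: (fd _ (fun i => (nth (0, 0) l i).1) (fun i => (nth (0, 0) l i).2)) => //.
  by move=> i; have /and3P[] := lab _ (mem_nth (0, 0) (ltn_ord i)).
move=> i j ij; have /pairwiseP := pl => /(_ (0, 0)) pl'.
have [||ji] := ltngtP i j.
- by left; apply: pl' => //; rewrite !inE.
- by right; apply: pl' => //; rewrite !inE.
- by move: ij; rewrite -val_eqE/= ji eqxx.
Qed.

(* The exceptional null set is covered by an open [U] of small measure; a
   continuous induction along [a, b] pays for the increments of [G] with the
   slope [e] outside of [U] and, inside of [U], with absolute continuity. *)
Lemma abs_continuous_on_le0_nincr a b (G : R -> R) : a <= b ->
  abs_continuous_on a b G ->
  {ae mu, forall t, a <= t <= b -> derivable G t 1 /\ 'D_1 G t <= 0} ->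
  G b <= G a.
Proof.
move=> ab acG aeG; apply/ler_addgt0Pr => e0 e00.
(* Slope [e] over the whole interval plus a total increment [e] inside the open set cost
   [e * (b - a) + e = e0]. *)
pose e := e0 / (b - a + 1).
have ba1 : 0 < b - a + 1 by rewrite ltr_wpDl// subr_ge0.
have epos : 0 < e by rewrite divr_gt0.
have [d d0 Gd] := abs_continuous_on_seq acG epos.
have [U [oU NU mU]] : exists U : set R, [/\ open U,
    ~` [set t | a <= t <= b -> derivable G t 1 /\ 'D_1 G t <= 0] `<=` U
    & (mu U < d%:E)%E].
  have /(negligible_outer_measure _).1 N0 : mu.-negligible
      (~` [set t | a <= t <= b -> derivable G t 1 /\ 'D_1 G t <= 0]) := aeG.
  have d20 : 0 < d / 2 by rewrite divr_gt0.
  have [U [oU NU mU]] := outer_measure_open_le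
    (~` [set t | a <= t <= b -> derivable G t 1 /\ 'D_1 G t <= 0]) d20.
  exists U; split => //; apply: (le_lt_trans mU).
  by rewrite N0 add0e lte_fin ltr_pdivrMr// mulr_natr mulr2n ltrDl.
have measU : measurable U by exact: open_measurable.
(* [l] records the intervals crossed inside [U]. Bounding their total length by the measure of [U]
   to the left of [t] keeps it below [d]. *)
pose J t := exists l : seq (R * R), [/\
  all (fun p => [&& a <= p.1, p.1 <= p.2 & p.2 <= t]) l,
  pairwise (fun p q => p.2 <= q.1) l,
  ((\sum_(p <- l) (p.2 - p.1))%:E <= mu (U `&` `[a, t[))%E
  & G t - G a <= e * (t - a) + \sum_(p <- l) `|G p.2 - G p.1|].
have J_a : J a.
  exists [::]; rewrite !big_nil; split => //.
  by rewrite !subrr mulr0 addr0.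
have J_step t1 t2 : a <= t1 -> t1 <= t2 -> J t1 ->
    `[t1, t2[ `<=` U \/ G t2 - G t1 <= e * (t2 - t1) -> J t2.
  move=> at1 t12 [l [l1 l2 l3 l4]] [tU|Gt].
    exists (rcons l (t1, t2)); rewrite !big_rcons/= all_rcons pairwise_rcons; split.
    - rewrite /= at1 t12 lexx/=; apply: sub_all l1 => p /and3P[-> -> /=].
      by move/le_trans; exact.
    - by rewrite l2 andbT; apply: sub_all l1 => p /and3P[].
    - have -> : U `&` `[a, t2[ = (U `&` `[a, t1[) `|` `[t1, t2[.
        rewrite (@itv_bndbnd_setU _ _ _ (BLeft t1)) ?bnd_simp// setIUr.
        by congr (_ `|` _); apply/setIidPr.
      rewrite measureU//; first last.
      + rewrite -subset0 => t [[_]] /=; rewrite !in_itv/= => /andP[_ tt1].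
        by move=> /andP[]; rewrite leNgt tt1.
      + exact: measurableI.
      rewrite EFinD leeD//= lebesgue_measure_itv/= lte_fin.
      by case: ltP => // t21; rewrite lee_fin; lra.
    - have := ler_norm (G t2 - G t1); have := ler_wpM2l (ltW epos) t12; lra.
  exists l; split => //.
  - apply: sub_all l1 => p /and3P[-> -> /=].
    by move/le_trans; exact.
  - apply: (le_trans l3); apply: le_measure; rewrite ?inE.
    + exact: measurableI.
    + exact: measurableI.
    + by apply: setIS; apply: subset_itvl; rewrite bnd_simp.
  - lra.
(* Derivability at [t] controls only difference quotients based at [t], so one endpoint must be [t].
   This is enough to reach the supremum of [S] from the left and to leave it to the right. *)
have gauge t : a <= t <= b -> exists2 r, 0 < r &
    forall t1 t2, t - r < t1 -> t1 <= t2 -> t2 < t + r -> t1 = t \/ t2 = t ->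
    `[t1, t2[ `<=` U \/ G t2 - G t1 <= e * (t2 - t1).
  move=> tab; have [Ut|Ut] := pselect (U t).
    have [r /= r0 rU] : nbhs_ball t U by apply/nbhs_ballP; exact: open_nbhs_nbhs.
    exists r => // t1 t2 t1r t12 t2r _; left => u /=; rewrite in_itv/= => /andP[u1 u2].
    by apply: rU; rewrite /ball/= ltr_norml; apply/andP; split; lra.
  have [dG DG] : derivable G t 1 /\ 'D_1 G t <= 0.
    by have := contra_not (@NU t) Ut; rewrite /= => /contrapT; exact.
  have /cvgrPdist_lt/(_ e epos) : h^-1 *: ((G \o shift t) (h *: 1) - G t)
    @[h --> 0^'] --> 'D_1 G t by exact: dG.
  move=> /nbhs_ballP[r /= r0 rG]; exists r => // t1 t2 t1r t12 t2r tt; right.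
  have [->|t12ne] := eqVneq t1 t2; first by rewrite !subrr mulr0.
  have {}t12 : 0 < t2 - t1 by rewrite subr_gt0 lt_neqAle t12ne.
  case: tt => ?; subst t.
    have := rG (t2 - t1); rewrite /ball/= sub0r normrN gtr0_norm// subr_eq0 eq_sym t12ne.
    rewrite [_ *: 1]mulr1 subrK => /(_ _ isT) rG'.
    have /rG' : t2 - t1 < r by lra.
    rewrite ltr_norml => /andP[+ _]; rewrite -[_ *: _]/(_ * _) => rG1.
    rewrite -ler_pdivrMr// mulrC; lra.
  have := rG (t1 - t2); rewrite /ball/= sub0r normrN ltr0_norm; last by lra.
  rewrite opprB subr_eq0 t12ne [_ *: 1]mulr1 subrK => /(_ _ isT) rG'.
  have /rG' : t2 - t1 < r by lra.
  rewrite ltr_norml => /andP[+ _]; rewrite -[_ *: _]/(_ * _).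
  rewrite -[t1 - t2]opprB -[G t1 - G t2]opprB invrN mulrNN => rG1.
  rewrite -ler_pdivrMr// mulrC; lra.
pose S := [set t | a <= t <= b /\ J t].
have S_a : S a by split => //; rewrite lexx.
have supS : has_sup S.
  by split; [exists a|exists b => t [/andP[]]].
have sup_ab : a <= sup S <= b.
  apply/andP; split; first exact: (sup_upper_bound supS).
  by apply: ge_sup => //; [exists a|move=> t [/andP[]]].
have [r r0 rS] := gauge _ sup_ab.
have [t1 [t1ab Jt1] t1S] := sup_adherent r0 supS.
have t1le : t1 <= sup S by exact: (sup_upper_bound supS).
have /andP[supa supb] := sup_ab.
have Jsup : J (sup S).
  apply: (J_step t1) => //; first by case/andP: t1ab.
  by apply: rS => //; [rewrite ltrDl|right].
have bS : b = sup S.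
  apply/eqP; rewrite eq_le supb andbT leNgt; apply/negP => Sb.
  pose t2 := Num.min b (sup S + r / 2).
  have St2 : sup S < t2 by rewrite lt_min Sb ltrDl divr_gt0.
  have : S t2.
    split; first by rewrite ge_min lexx andbT (le_trans supa)// ltW.
    apply: (J_step (sup S)) => //; first exact: ltW.
    apply: rS; [by rewrite ltrBlDr ltrDl|exact: ltW| |by left].
    by rewrite gt_min ltrD2l ltr_pdivrMr// ltr_pMr// ltr1n orbT.
  by move/(sup_upper_bound supS); rewrite leNgt St2.
move: Jsup; rewrite -bS => -[l [l1 l2 l3 l4]].
have := Gd l l1 l2; rewrite -lte_fin => /(_ _)/wrap[].
  apply: (le_lt_trans l3); apply: le_lt_trans mU.
  apply: le_measure; rewrite ?inE//; exact: measurableI.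
move=> Gl; rewrite -lerBlDl; apply: (le_trans l4).
have -> : e0 = e * (b - a) + e.
  by rewrite -[X in _ + X]mulr1 -mulrDr divfK// gt_eqF.
by rewrite lerD2l ltW.
Qed.

End absolute_continuity.

(** * Real derivatives and integrals *)

Section real_calculus.
Context {R : realType}.
Implicit Types (a b s t : R) (f g : R -> R).

Lemma is_derive_add t f g (df dg : R) :
  is_derive t 1 f df -> is_derive t 1 g dg ->
  is_derive t 1 (fun s => f s + g s) (df + dg).
Proof. by move=> ? ?; exact: is_deriveD. Qed.

Lemma is_derive_mul t f g (df dg : R) :
  is_derive t 1 f df -> is_derive t 1 g dg ->
  is_derive t 1 (fun s => f s * g s) (df * g t + f t * dg).
Proof.
move=> fd gd; have := is_deriveM fd gd.
by rewrite addrC -![_ *: _]/(_ * _) (mulrC (g t)).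
Qed.

Lemma is_derive_scale t f (k df : R) :
  is_derive t 1 f df -> is_derive t 1 (fun s => k * f s) (k * df).
Proof. by move=> ?; exact: is_deriveZ. Qed.

Lemma is_derive_continuous (H : normedModType R) (f : R -> H) t df :
  is_derive t 1 f df -> {for t, continuous f}.
Proof. by move=> fd; apply/differentiable_continuous/derivable1_diffP. Qed.

Lemma is_derive_1Dpow (b t : R) : 0 <= t ->
  is_derive t 1 (fun s => (1 + s) `^ b) (b * (1 + t) `^ (b - 1)).
Proof.
move=> t0; have t1 : 0 < 1 + t by lra.
have d1 : is_derive t 1 (fun s : R => 1 + s) 1.
  by rewrite -[X in is_derive _ _ _ X]add0r; apply: is_derive_add.
have := @is_derive1_comp _ (fun y => y `^ b) (fun s => 1 + s) t _ 1
  (is_derive1_powR b t1) d1.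
by rewrite mulr1.
Qed.

Lemma derive_MVT a b f (df : R -> R) : a <= b ->
  (forall t, a <= t <= b -> is_derive t 1 f (df t)) ->
  exists2 c, a <= c <= b & f b - f a = df c * (b - a).
Proof.
move=> ab fdf; have [||c cab fc] := @MVT_segment _ f df a b ab _.
- by move=> t; rewrite in_itv/= => /andP[/ltW ta /ltW tb]; apply: fdf; rewrite ta.
- apply: derivable_within_continuous => t; rewrite in_itv/= => /fdf.
  by move=> ft; exact: ex_derive.
- by move: cab; rewrite in_itv/=; exists c.
Qed.

Lemma derive_le0_nincr a b f (df : R -> R) : a <= b ->
  (forall t, a <= t <= b -> is_derive t 1 f (df t)) ->
  (forall t, a <= t <= b -> df t <= 0) -> f b <= f a.
Proof.
move=> ab fdf df0; have [c cab fc] := derive_MVT ab fdf.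
by rewrite -subr_le0 fc mulr_le0_ge0 ?df0// subr_ge0.
Qed.

(** A continuous derivative is bounded on the compact interval, hence the function is Lipschitz
    there. *)
Lemma derive_abs_continuous_on a b f (df : R -> R) :
  (forall t, a <= t <= b -> is_derive t 1 f (df t)) ->
  (forall t, a <= t <= b -> {for t, continuous df}) ->
  abs_continuous_on a b f.
Proof.
move=> fdf cdf; have [ab|ba] := leP a b; last first.
  apply: (@lipschitz_abs_continuous_on _ _ _ _ _ 0) => s t a_s st tb.
  by have := le_trans (le_trans a_s st) tb; rewrite leNgt ba.
have : {within `[a, b], continuous (fun t => `|df t|)}.
  apply: continuous_in_subspaceT => t; rewrite inE/= in_itv/= => /cdf ct.
  by apply: continuous_comp; [exact: ct|exact: norm_continuous].
move=> /(EVT_max ab)[c _ dfc].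
apply: (@lipschitz_abs_continuous_on _ _ _ _ _ `|df c|) => s t a_s st tb.
have [|z /andP[sz zt] ->] := @derive_MVT s t f df st.
  by move=> z /andP[sz zt]; apply: fdf; rewrite (le_trans a_s)// (le_trans zt).
rewrite normrM (ger0_norm (_ : 0 <= t - s)) ?subr_ge0// ler_wpM2r ?subr_ge0//.
by apply: dfc; rewrite in_itv/= (le_trans a_s)// (le_trans zt).
Qed.

Lemma abs_continuous_on_expR a b (u : R -> R) : abs_continuous_on a b u ->
  abs_continuous_on a b (fun t => expR (u t)).
Proof.
move=> acu; have [M M0 uM] := abs_continuous_on_bounded acu.
have expM y z : y <= z -> z <= M -> `|expR z - expR y| <= expR M * `|z - y|.
  move=> yz zM; have [w /andP[yw wz] ->] := @derive_MVT y z expR expR yz _.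
  rewrite normrM ler_wpM2r// ger0_norm ?expR_ge0// ler_expR.
  exact: le_trans zM.
apply: (abs_continuous_on_le (L := expR M) acu (@abs_continuous_on_cst _ R a b 0)).
move=> s t a_s st tb; rewrite subrr normr0 addr0.
have us : u s <= M.
  by rewrite (le_trans (ler_norm _))// uM// a_s (le_trans st).
have ut : u t <= M.
  by rewrite (le_trans (ler_norm _))// uM// tb (le_trans a_s).
have [uts|/ltW uts] := leP (u s) (u t); first exact: expM.
by rewrite distrC (distrC (u t)); exact: expM.
Qed.

(** Once within [e] of its supremum, the function can rise by at most [e] more. *)
Lemma nondecreasing_bounded_cauchy (f : R -> R) a M :
  (forall s t, a <= s -> s <= t -> f s <= f t) -> (forall t, a <= t -> f t <= M) ->
  forall e, 0 < e -> exists2 u, a <= u & forall s t, u <= s -> s <= t -> f t - f s <= e.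
Proof.
move=> fnd fM e e0; pose S := [set f t | t in [set t | a <= t]].
have supS : has_sup S.
  split; first by exists (f a), a => //=.
  by exists M => _ [t /= ta <-]; exact: fM.
have [_ [u /= au <-] ue] := sup_adherent e0 supS.
exists u => // s t us st.
have ft : f t <= sup S.
  by apply: (sup_upper_bound supS); exists t => //=; rewrite (le_trans au)// (le_trans us).
have := fnd u s au us; lra.
Qed.

End real_calculus.

(** * Primitives of nonnegative integrable functions *)

Section indefinite_integral.
Context {R : realType}.
Notation mu := (@lebesgue_measure R).
Variable phi : R -> R.
Hypothesis phi0 : forall t, 0 <= phi t.
Hypothesis intphi : mu.-integrable setT (EFin \o phi).
Let A t := (\int[mu]_(s in `]-oo, t]) phi s)%R.

Let integrable_phi (D : set R) : measurable D -> mu.-integrable D (EFin \o phi).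
Proof. by move=> mD; apply: integrableS intphi. Qed.

(** Lebesgue differentiation: [phi] is not continuous, so its primitive is differentiable only
    almost everywhere. *)
Lemma indefinite_integral_ae :
  {ae mu, forall t : R, is_derive t 1 A (phi t)}.
Proof.
have lphi : locally_integrable [set: R] phi.
  have /integrableP[/measurable_EFinP mphi intp] := intphi.
  split => //; first exact: openT.
  move=> K _ cK; apply: le_lt_trans intp.
  apply: ge0_subset_integral => //.
  - by apply: compact_measurable.
  - by apply/measurable_EFinP; apply: measurableT_comp.
have := FTC1Ny (fun y => integrable_phi (measurable_itv `]-oo, y])) lphi.
apply: filterS; first exact: (ae_filter_ringOfSetsType mu).
by move=> t [dA DA]; split; [exact: dA|rewrite -derive1E; exact: DA].
Qed.

Lemma indefinite_integralB s t : s <= t ->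
  A t - A s = (\int[mu]_(r in `]s, t]) phi r)%R.
Proof.
move=> st; rewrite /A (@itv_bndbnd_setU _ _ _ (BRight s)) ?bnd_simp//.
rewrite Rintegral_setU//.
- by rewrite addrC addKr.
- by apply: integrable_phi; exact: measurableU.
- apply/disj_setPS => r [] /=; rewrite !in_itv/= => rs /andP[].
  by rewrite ltNge rs.
Qed.

Lemma indefinite_integral_nondecreasing s t : s <= t -> A s <= A t.
Proof.
by move=> st; rewrite -subr_ge0 indefinite_integralB//; exact: Rintegral_ge0.
Qed.

Lemma indefinite_integral_le t : A t <= (\int[mu]_s phi s)%R.
Proof.
rewrite /A /Rintegral fine_le//.
- exact: integrable_fin_num (integrable_phi (measurable_itv _)).
- exact: integrable_fin_num.
- apply: ge0_subset_integral => //=; first by case/integrableP: intphi.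
  by move=> s _; rewrite lee_fin.
Qed.

Lemma indefinite_integral_abs_continuous a b : abs_continuous_on a b A.
Proof.
move=> e e0; have [d [d0 Ad]] := integral_normr_continuous intphi e0.
exists d => // n s t st dst std.
have st' i : s i <= t i by have [_ []] := st i.
have mF i : measurable (`]s i, t i] : set R) by exact: measurable_itv.
have trF : trivIset [set` index_enum 'I_n] (fun i => `]s i, t i]%classic).
  apply/trivIsetP => i j _ _ ij; rewrite -subset0 => r [] /=; rewrite !in_itv/=.
  move=> /andP[sr rt] /andP[sr' rt'].
  have [tij|tji] := dst i j ij.
    by have := lt_le_trans sr' (le_trans rt tij); rewrite ltxx.
  by have := lt_le_trans sr (le_trans rt' tji); rewrite ltxx.
(* The half-open intervals are disjoint, so the sum of increments of [A] is one integral over [D],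
   small because [D] has small measure. *)
set D := \big[setU/set0]_(i < n) `]s i, t i]%classic.
have mD : measurable D by exact: bigsetU_measurable.
have muD : (mu D < d%:E)%E.
  rewrite -[mu D]mul1e -integral_cst//.
  rewrite ge0_integral_bigsetU ?index_enum_uniq//.
  under eq_bigr do rewrite integral_cst//= mul1e lebesgue_measure_itv/=.
  rewrite (eq_bigr (fun i => (t i - s i)%:E)).
    by rewrite sumEFin lte_fin.
  move=> i _; rewrite lte_fin; case: ltP => //.
  by move=> tsi; rewrite (@le_anti _ R (t i) (s i)) ?subrr// tsi st'.
apply: le_lt_trans (Ad D mD muD); rewrite -lee_fin.
rewrite /Rintegral fineK; last first.
  apply: integrable_fin_num => //.
  by apply: (integrable_abse (integrable_phi mD)).
rewrite -sumEFin ge0_integral_bigsetU ?index_enum_uniq//; last first.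
  apply/measurable_EFinP; apply: measurableT_comp => //.
  by have /integrableP[/measurable_EFinP] := integrable_phi mD.
apply: lee_sum => i _; rewrite indefinite_integralB// ger0_norm; last first.
  exact: Rintegral_ge0.
rewrite /Rintegral fineK; last first.
  by apply: integrable_fin_num => //; exact: integrable_phi.
by rewrite le_eqVlt; apply/orP; left; apply/eqP; apply: eq_integral => r _; rewrite ger0_norm.
Qed.

End indefinite_integral.

(** * Integrals over half-lines and primitives of continuous functions *)

Section integral_bounds.
Context {R : realType}.
Notation mu := (@lebesgue_measure R).

(** Monotone convergence along the exhaustion by [[a, a + n]]. *)
Lemma ge0_integral_itvcy_le (f : R -> R) a M :
  (forall t, a <= t -> 0 <= f t) -> measurable_fun `[a, +oo[ f ->
  (forall T, a <= T -> (\int[mu]_(t in `[a, T]) (f t)%:E <= M%:E)%E) ->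
  (\int[mu]_(t in `[a, +oo[) (f t)%:E <= M%:E)%E.
Proof.
move=> f0 mf fM.
have bigcupE : `[a, +oo[%classic = \bigcup_n `[a, a + n%:R]%classic.
  apply/seteqP; split => t /=; rewrite ?in_itv/= ?andbT.
    move=> ta; have [n tn] : exists n, t - a <= n%:R.
      by exists (Num.truncn (t - a)).+1; rewrite ltW// truncnS_gt.
    by exists n => //=; rewrite in_itv/= ta/= -lerBlDl.
  by move=> [n _] /=; rewrite in_itv/= => /andP[].
have cvgI : (fun n => \int[mu]_(t in `[a, (a + n%:R)%R]) (f t)%:E)%E @ \oo -->
    (\int[mu]_(t in `[a, +oo[) (f t)%:E)%E.
  rewrite bigcupE; apply: ge0_nondecreasing_set_cvg_integral.
  - apply/nondecreasing_seqP => n; rewrite subsetEset; apply: subset_itvl.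
    by rewrite bnd_simp lerD2l ler_nat.
  - by move=> n; exact: measurable_itv.
  - move=> n; apply/measurable_EFinP; apply: measurable_funS mf => //.
    by apply: subset_itvl; rewrite bnd_simp.
  - by move=> n t /=; rewrite in_itv/= => /andP[ta _]; rewrite lee_fin f0.
rewrite -(cvg_lim _ cvgI)//.
apply: lime_le; first by apply/cvg_ex; eexists; exact: cvgI.
by apply: nearW => n; apply: fM; rewrite lerDl.
Qed.

Lemma continuous_primitive_is_derive (f : R -> R) a t : a < t ->
  {within `[a, t + 1], continuous f} -> {for t, continuous f} ->
  is_derive t 1 (fun y => \int[mu]_(s in `[a, y]) f s)%R (f t).
Proof.
move=> at_ cf cft.
have intf : mu.-integrable `[a, t + 1] (EFin \o f).
  by apply: continuous_compact_integrable => //; exact: segment_compact.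
have tt1 : t < t + 1 by rewrite ltrDl.
have [dF DF] := continuous_FTC1_closed tt1 intf at_ cft.
by split; [exact: dF|rewrite -derive1E; exact: DF].
Qed.

End integral_bounds.

(** * Inner products, gradients and convexity *)

Section hilbert.
Context {R : realType} {H : normedModType R}.
Variable ip : H -> H -> R.
Hypothesis ipP : is_inner_product ip.

Lemma ipC u v : ip u v = ip v u. Proof. by case: ipP. Qed.

Lemma norm_sqrE v : `|v| ^+ 2 = ip v v. Proof. by case: ipP. Qed.

Lemma ipDl u v w : ip (u + v) w = ip u w + ip v w.
Proof. by have [_ ipl _] := ipP; rewrite -[u]scale1r ipl mul1r scale1r. Qed.

Lemma ip0l w : ip 0 w = 0.
Proof. by have := ipDl 0 0 w; rewrite addr0; lra. Qed.

Lemma ipZl k u w : ip (k *: u) w = k * ip u w.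
Proof. by have [_ ipl _] := ipP; rewrite -[k *: u]addr0 ipl ip0l addr0. Qed.

Lemma ipBl u v w : ip (u - v) w = ip u w - ip v w.
Proof. by rewrite ipDl -scaleN1r ipZl mulN1r. Qed.

Lemma ipDr u v w : ip w (u + v) = ip w u + ip w v.
Proof. by rewrite !(ipC w) ipDl. Qed.

Lemma ipZr k u w : ip w (k *: u) = k * ip w u.
Proof. by rewrite !(ipC w) ipZl. Qed.

Lemma ipBr u v w : ip w (u - v) = ip w u - ip w v.
Proof. by rewrite !(ipC w) ipBl. Qed.

Lemma ip_le u v : `|ip u v| <= `|u| * `|v|.
Proof.
have [->|v0] := eqVneq v 0; first by rewrite ipC ip0l !normr0 mulr0.
have vv0 : 0 < `|v| ^+ 2 by rewrite exprn_gt0// normr_gt0.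
(* Division-free Cauchy-Schwarz: this square expands to |v|^2 (|u|^2 |v|^2 - <u,v>^2). *)
have := sqr_ge0 `|(`|v| ^+ 2) *: u - ip u v *: v|.
rewrite (norm_sqrE (_ - _)) ipBl !ipBr !ipZl !ipZr (ipC v u) -!norm_sqrE.
rewrite -(@ler_sqr _ `|ip u v|) ?nnegrE ?mulr_ge0// exprMn real_normK ?num_real//.
move=> h; rewrite -subr_ge0 -(pmulr_rge0 _ vv0); lra.
Qed.

(** Polarisation derives the joint continuity of [ip] from that of the norm. *)
Lemma ip_polar u v : ip u v = 4^-1 * (`|u + v| ^+ 2 - `|u - v| ^+ 2).
Proof.
by rewrite !norm_sqrE ipBl !ipBr !ipDl !ipDr (ipC v u); field.
Qed.

Lemma cvg_ip {T : Type} {F : set_system T} {FF : Filter F} (f g : T -> H) u v :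
  f @ F --> u -> g @ F --> v -> (fun x => ip (f x) (g x)) @ F --> ip u v.
Proof.
move=> fu gv; rewrite ip_polar; under eq_fun do rewrite ip_polar.
apply: cvgM; first exact: cvg_cst.
have sqr_cvg (w : T -> H) z : w @ F --> z -> (fun x => `|w x| ^+ 2) @ F --> `|z| ^+ 2.
  move=> wz; rewrite expr2; under eq_fun do rewrite expr2.
  by apply: cvgM; exact: cvg_norm.
by apply: cvgB; apply: sqr_cvg; [exact: cvgD|exact: cvgB].
Qed.

Lemma is_derive_ip (u v : R -> H) (t : R) du dv :
  is_derive t 1 u du -> is_derive t 1 v dv ->
  is_derive t 1 (fun s => ip (u s) (v s)) (ip du (v t) + ip (u t) dv).
Proof.
move=> ud vd.
have cu : h^-1 *: ((u \o shift t) (h *: 1) - u t) @[h --> 0^'] --> du.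
  by have := @ex_derive _ _ _ _ _ _ _ ud; rewrite -(@derive_val _ _ _ _ _ _ _ ud).
have cv : h^-1 *: ((v \o shift t) (h *: 1) - v t) @[h --> 0^'] --> dv.
  by have := @ex_derive _ _ _ _ _ _ _ vd; rewrite -(@derive_val _ _ _ _ _ _ _ vd).
have cvt : (v \o shift t) (h *: 1) @[h --> 0^'] --> v t.
  have ct : {for t, continuous v} := is_derive_continuous vd.
  have ht : (fun h : R => h *: 1 + t) @ (0 : R)^' --> t.
    rewrite -[X in _ --> X]add0r; under eq_fun do rewrite [_ *: 1]mulr1.
    by apply: cvgD; [exact: cvg_within|exact: cvg_cst].
  exact: (cvg_comp (fun h : R => h *: 1 + t) v ht ct).
have c : h^-1 *: (((fun s => ip (u s) (v s)) \o shift t) (h *: 1) - ip (u t) (v t))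
    @[h --> 0^'] --> ip du (v t) + ip (u t) dv.
  have -> : (fun h => h^-1 *: (((fun s => ip (u s) (v s)) \o shift t) (h *: 1)
      - ip (u t) (v t))) = (fun h => ip (h^-1 *: ((u \o shift t) (h *: 1) - u t))
      ((v \o shift t) (h *: 1)) + ip (u t) (h^-1 *: ((v \o shift t) (h *: 1) - v t))).
    apply/funext => h /=; rewrite ipZl ipZr ipBl ipBr -[_ *: _]/(_ * _); ring.
  by apply: cvgD; [exact: cvg_ip cu cvt|apply: cvg_ip cv; exact: cvg_cst].
by split; [apply/cvg_ex; eexists; exact: c|exact: cvg_lim c].
Qed.

(** The mean value theorem fails for vector values; it is applied to the scalar function <x(r), w>,
    with [w] the increment to be estimated. *)
Lemma derive_lipschitz (a b : R) (x xd : R -> H) M :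
  (forall t, a <= t <= b -> is_derive t 1 x (xd t)) ->
  (forall t, a <= t <= b -> `|xd t| <= M) ->
  forall s t, a <= s -> s <= t -> t <= b -> `|x t - x s| <= M * (t - s).
Proof.
move=> xxd xdM s t a_s st tb; set w := x t - x s.
have [->|w0] := eqVneq w 0.
  rewrite normr0 mulr_ge0// ?subr_ge0//.
  by apply: le_trans (xdM s _) => //; rewrite a_s (le_trans st).
have [r|r /andP[sr rt]] := @derive_MVT _ s t (fun r => ip (x r) w) (fun r => ip (xd r) w) st.
  move=> /andP[sr rt]; have xr : is_derive r 1 x (xd r).
    by apply: xxd; rewrite (le_trans a_s)// (le_trans rt).
  have := is_derive_ip xr (is_derive_cst w r (1 : R)).
  by rewrite (ipC (x r) 0) ip0l addr0.
rewrite -ipBl -/w -norm_sqrE expr2 => wE.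
have : `|w| * `|w| <= M * (t - s) * `|w|.
  rewrite wE mulrAC ler_wpM2r ?subr_ge0//.
  rewrite (le_trans (ler_norm _))// (le_trans (ip_le _ _))// ler_wpM2r//.
  by apply: xdM; rewrite (le_trans a_s)// (le_trans rt).
by rewrite ler_pM2r// normr_gt0.
Qed.

Lemma abs_continuous_on_ip a b (u v : R -> H) :
  abs_continuous_on a b u -> abs_continuous_on a b v ->
  abs_continuous_on a b (fun t => ip (u t) (v t)).
Proof.
move=> acu acv; have [M M0 uM] := abs_continuous_on_bounded acu.
have [N N0 vN] := abs_continuous_on_bounded acv.
apply: (abs_continuous_on_le (L := M + N) acu acv) => s t a_s st tb.
have -> : ip (u t) (v t) - ip (u s) (v s) =
    ip (u t - u s) (v t) + ip (u s) (v t - v s) by rewrite ipBl ipBr; ring.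
have vt : `|v t| <= N by apply: vN; rewrite tb andbT (le_trans a_s).
have us : `|u s| <= M by apply: uM; rewrite a_s (le_trans st).
apply: (le_trans (ler_normD _ _)); apply: (le_trans (lerD (ip_le _ _) (ip_le _ _))).
have := normr_ge0 (u t - u s); have := normr_ge0 (v t - v s).
have := normr_ge0 (v t); have := normr_ge0 (u s).
nra.
Qed.

Variables (Phi : H -> R) (gradPhi : H -> H).
Hypothesis gradP : is_C1_gradient ip Phi gradPhi.

Lemma is_derive_comp_gradient (x : R -> H) (t : R) dx : is_derive t 1 x dx ->
  is_derive t 1 (Phi \o x) (ip (gradPhi (x t)) dx).
Proof.
move=> xd; have [dPhi gradE] := gradP.1 (x t).
have dx_ : differentiable x t by apply/derivable1_diffP; exact: ex_derive.
have dc : differentiable (Phi \o x) t by exact: differentiable_comp.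
split; first exact/derivable1_diffP.
by rewrite deriveE// diff_comp//= gradE -deriveE// derive_val.
Qed.

(** For 0 < h <= 1 convexity bounds the difference quotient of [Phi] at [u] along [v - u] by
    [Phi v - Phi u]; the right limit at 0 is the gradient term. *)
Lemma convex_gradient_le u v : convex_on_space Phi ->
  Phi u + ip (gradPhi u) (v - u) <= Phi v.
Proof.
move=> cvxPhi; have [dPhi gradE] := gradP.1 u.
rewrite -lerBrDl -gradE -deriveE//.
have c : h^-1 *: ((Phi \o shift u) (h *: (v - u)) - Phi u)
    @[h --> (0 : R)^'+] --> 'D_(v - u) Phi u.
  apply: cvg_trans (diff_derivable dPhi); apply: cvg_app.
  move=> A A0; rewrite /at_right; apply: (@filterS _ (nbhs (0 : R))) A0 => h hA h0.
  by apply: hA; rewrite gt_eqF.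
apply: (cvgr_to_le c); near=> h.
have h0 : 0 < h by [].
have h1 : h <= 1 by near: h; apply: nbhs_right_le.
rewrite -[_ *: _]/(_ * _) mulrC ler_pdivrMr//= lerBlDr.
have -> : h *: (v - u) + u = h *: v + (1 - h) *: u.
  by rewrite scalerBr scalerBl scale1r addrAC addrA.
apply: le_trans (cvxPhi _ _ _ _) _; first by rewrite ltW//= h1.
lra.
Unshelve. all: by end_near. Qed.

End hilbert.

(** * The Lyapunov function *)

Section lyapunov_algebra.
Context {R : realType}.

Lemma powR_mul_eq (s a b e : R) : 0 < s -> a + b = e -> s `^ a * s `^ b = s `^ e.
Proof. by move=> s0 <-; rewrite powRD//; apply/implyP; rewrite (gt_eqF s0). Qed.

(** Young's inequality: the cross term costs at most half of each of the two positive terms. *)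
Lemma cross_term_le (K c th a b Y : R) : 0 < K -> K * th ^+ 2 <= c / 4 ->
  a ^+ 2 / 2 <= Y ->
  Y / 2 + K * c * b ^+ 2 / 4 <= Y - K * th * (a * b) + K * c * b ^+ 2 / 2.
Proof.
move=> K0 Kth aY; have h1 := sqr_ge0 (a / 2 - K * th * b).
have h2 : K * (K * th ^+ 2) * b ^+ 2 <= K * (c / 4) * b ^+ 2.
  by rewrite ler_wpM2r ?sqr_ge0// ler_wpM2l// ltW.
lra.
Qed.

(* In applications [s = 1 + t], [p = s^nu], [w = s^((2 nu - 1 - alpha) / 2)],
   [th = s^(-(1 - alpha) / 2)], [s1 = s^(2 nu - 1)], [sa = s^(2 nu - alpha)];
   [n], [r], [G] are the norms of the velocity, of [x - xstar] and of the
   perturbation, [q] is their inner product and [V] the potential gap. *)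
Lemma lyapunov_lower (K c s1 p w th n r V q E : R) : 0 < K -> 0 <= V ->
  0 <= p -> 0 <= w -> 0 <= th ->
  K * th ^+ 2 <= c / 4 -> s1 = p * w * th -> `|q| <= r * n ->
  E = p ^+ 2 * (n ^+ 2 / 2 + V) + K * (s1 * q + c * (w ^+ 2 * (r ^+ 2 / 2))) ->
  p ^+ 2 * (n ^+ 2 / 2 + V) / 2 + K * c * (w * r) ^+ 2 / 4 <= E.
Proof.
move=> K0 V0 p0 w0 th0 Kth s1E qle ->.
have aY : (p * n) ^+ 2 / 2 <= p ^+ 2 * (n ^+ 2 / 2 + V).
  by rewrite exprMn -mulrA ler_wpM2l ?sqr_ge0// lerDl.
apply: le_trans (cross_term_le (w * r) K0 Kth aY) _.
have : - (s1 * q) <= s1 * (r * n).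
  rewrite -mulrN ler_wpM2l//; first by rewrite s1E !mulr_ge0.
  by rewrite (le_trans _ qle)// -normrN ler_norm.
rewrite -(ler_pM2l K0) s1E => h; rewrite exprMn; lra.
Qed.

(** The derivative estimate with all calculus removed. [gx] and [gr] stand for the products of the
    perturbation with x' and x - xstar, [gradr] for <grad Phi (x), x - xstar>, and [X] for the term
    from differentiating the weight of h. *)
Lemma lyapunov_derivative_le (nu K c s s1 s2 sa p w th n r G V q gx gr gradr E X : R) :
  0 <= nu <= 1 -> K = 2 * nu + 1 -> 0 < c -> 1 <= s -> 0 <= sa -> 0 <= V ->
  0 <= p -> 0 <= w -> 0 <= th <= 1 -> 0 <= n -> 0 <= r -> 0 <= G -> X <= 0 ->
  K * th ^+ 2 <= c / 4 -> s1 = p * w * th -> s1 = th ^+ 2 * sa -> s2 = s1 / s ->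
  `|q| <= r * n -> gx <= G * n -> gr <= r * G -> V <= gradr ->
  E = p ^+ 2 * (n ^+ 2 / 2 + V) + K * (s1 * q + c * (w ^+ 2 * (r ^+ 2 / 2))) ->
  2 * nu * s1 * (n ^+ 2 / 2 + V) + p ^+ 2 * gx - c * sa * n ^+ 2
    + K * ((2 * nu - 1) * s2 * q + s1 * (n ^+ 2 + gr - gradr) + X)
  <= - (s1 * (n ^+ 2 / 2 + V) + c / 2 * (sa * n ^+ 2))
     + ((2 + K / c) * (p * G) + (2 * K + 2 / c) * (th / s)) * (1 + E).
Proof.
move=> /andP[nu0 nu1] KE c0 s_ge1 sa0 V0 p0 w0 /andP[th0 th1] n0 r0 G0 X0 Kth s1E s1E' s2E.
move=> qle gxle grle Vle EE.
have K0 : 0 < K by lra.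
have s10 : 0 <= s1 by rewrite s1E !mulr_ge0.
have s0 : 0 < s by lra.
have lowE := lyapunov_lower K0 V0 p0 w0 th0 Kth s1E qle EE.
pose a := p * n; pose b := w * r.
have a0 : 0 <= a by exact: mulr_ge0.
have b0 : 0 <= b by exact: mulr_ge0.
have aE : a ^+ 2 / 4 + K * c * b ^+ 2 / 4 <= E.
  apply: le_trans lowE; rewrite lerD2r.
  have : 0 <= p ^+ 2 * V by rewrite mulr_ge0 ?sqr_ge0.
  rewrite /a exprMn; lra.
have b20 : 0 <= K * c * b ^+ 2 by rewrite mulr_ge0 ?sqr_ge0// mulr_ge0 ?ltW.
have a20 : 0 <= a ^+ 2 by rewrite sqr_ge0.
have E0 : 0 <= E by lra.
have Kc0 : 0 <= K / c by rewrite divr_ge0 ?ltW.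
(* The perturbation enters linearly in [a] and [b], while [E] controls their squares; completing
   squares costs the constants 1 and [K / c], whence [1 + E]. *)
have abE : a + K * b <= (2 + K / c) * (1 + E).
  have ha : a <= 1 + a ^+ 2 / 4 by have := sqr_ge0 (a / 2 - 1); lra.
  have hb : K * b <= K / c + K * c * b ^+ 2 / 4.
    have : 0 <= (K / c) * (1 - c * b / 2) ^+ 2 by rewrite mulr_ge0 ?sqr_ge0.
    have -> : K / c * (1 - c * b / 2) ^+ 2 = K / c - K * b + K * c * b ^+ 2 / 4.
      by field; rewrite gt_eqF.
    lra.
  have := mulr_ge0 Kc0 E0; lra.
have abE' : K * (a * b) <= (2 * K + 2 / c) * E.
  have h1 : a ^+ 2 <= 4 * E by lra.
  have h2 : K * b ^+ 2 <= 4 / c * E.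
    by rewrite mulrAC ler_pdivlMr//; lra.
  have h3 : 2 * (a * b) <= a ^+ 2 + b ^+ 2 by have := sqr_ge0 (a - b); lra.
  have -> : (2 * K + 2 / c) * E = 2 * K * E + 4 / c * E / 2.
    by field; rewrite gt_eqF.
  have := ler_wpM2l (ltW K0) h3; have := ler_wpM2l (ltW K0) h1; lra.
have T1 : s1 * V <= s1 * gradr by exact: ler_wpM2l.
have T2 : p ^+ 2 * gx <= p * G * a.
  have := ler_wpM2l (sqr_ge0 p) gxle; rewrite /a; lra.
have T3 : K * (s1 * gr) <= p * G * (K * b).
  have h1 : s1 * gr <= s1 * (r * G) by exact: ler_wpM2l.
  have h2 : p * G * b * th <= p * G * b * 1 by apply: ler_wpM2l => //; rewrite !mulr_ge0.
  have h3 : s1 * gr <= p * G * b.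
    by apply: (le_trans h1); move: h2; rewrite s1E /b; lra.
  have := ler_wpM2l (ltW K0) h3; lra.
have ths0 : 0 <= th / s by exact: divr_ge0 th0 (ltW s0).
(* As |2 nu - 1| <= 1 and [s2 = p * w * th / s], the derivative of the cross weight leaves exactly
   the factor [th / s]. *)
have T4 : K * ((2 * nu - 1) * s2 * q) <= th / s * (K * (a * b)).
  have h1 : (2 * nu - 1) * s2 * q <= s2 * (r * n).
    rewrite mulrAC [leRHS]mulrC ler_wpM2r ?s2E ?divr_ge0 ?(ltW s0)//.
    rewrite (le_trans (ler_norm _))// normrM (le_trans _ qle)//.
    by rewrite ler_piMl// ler_norml; apply/andP; split; lra.
  have := ler_wpM2l (ltW K0) h1; rewrite s2E s1E /a /b; lra.
(* The kinetic terms to absorb, including the one in the dissipation on the right, total 3/2 K s1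
   n^2. This is at most 3/8 c sa n^2, which fits into the half of the damping that is given up. *)
have T5 : K * s1 * n ^+ 2 <= c / 4 * (sa * n ^+ 2).
  have : 0 <= sa * n ^+ 2 by rewrite mulr_ge0 ?sqr_ge0.
  move=> /(ler_wpM2r) /(_ _ _ Kth); rewrite s1E'; lra.
have T6 : p * G * (a + K * b) <= p * G * ((2 + K / c) * (1 + E)).
  by apply: ler_wpM2l => //; exact: mulr_ge0.
have T7 : th / s * (K * (a * b)) <= th / s * ((2 * K + 2 / c) * (1 + E)).
  apply: ler_wpM2l => //; apply: (le_trans abE').
  rewrite ler_wpM2l ?lerDr//.
  by rewrite addr_ge0// ?divr_ge0 ?mulr_ge0 ?ltW.
have T8 : 0 <= c * (sa * n ^+ 2) by rewrite !mulr_ge0 ?sqr_ge0 ?(ltW c0).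
have T9 : K * X <= 0 by exact: mulr_ge0_le0 (ltW K0) X0.
rewrite (_ : 2 * nu = K - 1) in T4 *; last by lra.
have T10 := ler_wpM2l (ltW K0) T1.
clear -T2 T3 T4 T5 T6 T7 T8 T9 T10; lra.
Qed.

End lyapunov_algebra.

(** * The trajectory, its energy and its Lyapunov function *)

Section heavy_ball.
Context {R : realType} {H : normedModType R}.
Notation mu := (@lebesgue_measure R).
Variables (ip : H -> H -> R) (Phi : H -> R) (gradPhi : H -> H) (xstar : H).
Variables (c alpha nu : R) (g : R -> H) (x xd : R -> H).
Hypothesis ipP : is_inner_product ip.
Hypothesis cvxPhi : convex_on_space Phi.
Hypothesis gradP : is_C1_gradient ip Phi gradPhi.
Hypothesis xstar_min : forall y : H, Phi xstar <= Phi y.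
Hypothesis c0 : 0 < c.
Hypothesis alpha01 : 0 <= alpha < 1.
Hypothesis mg : measurable_fun (`[0%R, +oo[ : set R) (fun t : R => `|g t|).
Hypothesis xxd : forall t : R, 0 < t -> is_derive t 1 x (xd t).
Hypothesis xd_ac : forall T : R, 0 <= T -> abs_continuous_on 0 T xd.
Hypothesis ode : {ae mu, forall t : R, 0 <= t ->
  derivable xd t 1 /\
  'D_1 xd t + (c / (1 + t) `^ alpha) *: xd t + gradPhi (x t) = g t}.
Hypothesis nu_bounds : alpha <= nu <= (1 + alpha) / 2.
Hypothesis int_g :
  (\int[mu]_(t in `[0%R, +oo[ : set R) ((1 + t) `^ nu * `|g t|)%:E < +oo)%E.

Definition energy (t : R) : R :=
  2^-1 * ip (xd t) (xd t) + (Phi (x t) - Phi xstar).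

Definition lyapunov (t : R) : R := (1 + t) `^ (2 * nu) * energy t +
  (2 * nu + 1) * ((1 + t) `^ (2 * nu - 1) * ip (x t - xstar) (xd t) +
    c * ((1 + t) `^ (2 * nu - 1 - alpha) *
         (2^-1 * ip (x t - xstar) (x t - xstar)))).

(** The extension by zero makes it integrable on the whole line, as the primitive from -oo
    requires. *)
Definition forcing : R -> R := (fun t => (1 + t) `^ nu * `|g t|) \_ `[0, +oo[.

Definition forcing_primitive (t : R) : R := (\int[mu]_(s in `]-oo, t]) forcing s)%R.

Lemma forcing_ge0 t : 0 <= forcing t.
Proof. by rewrite /forcing patchE; case: ifP => // _; rewrite mulr_ge0 ?powR_ge0. Qed.

Lemma forcingE t : 0 <= t -> forcing t = (1 + t) `^ nu * `|g t|.
Proof. by move=> t0; rewrite /forcing patchE mem_set//= in_itv/= t0. Qed.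

Lemma integrable_forcing : mu.-integrable setT (EFin \o forcing).
Proof.
rewrite /forcing -restrict_EFin; apply/(integrable_mkcond _ _).1 => //.
apply/integrableP; split.
  apply/measurable_EFinP; apply: measurable_funM => //.
  apply: measurable_funTS; apply: (measurableT_comp (measurable_powR nu)).
  exact: measurable_funD.
apply: le_lt_trans int_g; rewrite le_eqVlt; apply/orP; left; apply/eqP.
by apply: eq_integral => t _ /=; rewrite ger0_norm// mulr_ge0 ?powR_ge0.
Qed.

Lemma nu_ge0 : 0 <= nu. Proof. by case/andP: alpha01 nu_bounds => ? ? /andP[]; lra. Qed.

Lemma nu_le1 : nu <= 1. Proof. by case/andP: alpha01 nu_bounds => ? ? /andP[]; lra. Qed.

Lemma potential_ge0 t : 0 <= Phi (x t) - Phi xstar.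
Proof. by rewrite subr_ge0. Qed.

Lemma energy_ge0 t : 0 <= energy t.
Proof. by rewrite addr_ge0 ?potential_ge0// mulr_ge0// -norm_sqrE ?sqr_ge0. Qed.

Lemma powR_abs_continuous a b (e : R) : 0 <= a ->
  abs_continuous_on a b (fun t : R => (1 + t) `^ e).
Proof.
move=> a0; apply: (@derive_abs_continuous_on _ _ _ _ (fun t => e * (1 + t) `^ (e - 1))).
  by move=> t /andP[at_ _]; apply: is_derive_1Dpow; exact: le_trans at_.
move=> t /andP[at_ _]; have t0 : 0 <= t by exact: le_trans at_.
exact: is_derive_continuous (is_derive_scale e (is_derive_1Dpow (e - 1) t0)).
Qed.

Lemma velocity_abs_continuous a b : 0 <= a -> abs_continuous_on a b xd.
Proof.
move=> a0; apply: (abs_continuous_on_sub a0 _ (xd_ac (_ : 0 <= Num.max 0 b))).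
  by rewrite le_max lexx orbT.
by rewrite le_max lexx.
Qed.

(** The velocity is bounded on compact intervals, so [x] is Lipschitz there; [a] is positive because
    [x] is differentiated only at positive times. *)
Lemma position_abs_continuous a b : 0 < a ->
  abs_continuous_on a b (fun t => x t - xstar).
Proof.
move=> a0; have [M _ xdM] := abs_continuous_on_bounded (velocity_abs_continuous b (ltW a0)).
apply: (@lipschitz_abs_continuous_on _ _ _ _ _ M) => s t a_s st tb.
rewrite opprB addrA subrK; apply: (derive_lipschitz ipP _ xdM) => // r /andP[ar _].
by apply: xxd; exact: lt_le_trans ar.
Qed.

(** The potential part is C^1 in time, its derivative <grad Phi (x), x'> being continuous; the
    kinetic part inherits absolute continuity from [xd]. *)
Lemma energy_abs_continuous a b : 0 < a -> abs_continuous_on a b energy.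
Proof.
move=> a0; have xda := velocity_abs_continuous b (ltW a0).
apply: abs_continuous_onD.
  by apply: abs_continuous_onZ; exact: (abs_continuous_on_ip ipP).
apply: abs_continuous_onD; last exact: abs_continuous_on_cst.
apply: (@derive_abs_continuous_on _ _ _ _ (fun t => ip (gradPhi (x t)) (xd t))).
  move=> t /andP[at_ _]; apply: (is_derive_comp_gradient gradP).
  by apply: xxd; exact: lt_le_trans at_.
move=> t /andP[at_ _]; have t0 : 0 < t by exact: lt_le_trans at_.
have cxd : {for t, continuous xd}.
  apply: (abs_continuous_on_continuous (velocity_abs_continuous (t + 1) (lexx 0))).
  by rewrite t0 ltrDl ltr01.
have cx : {for t, continuous x} := is_derive_continuous (xxd t0).
apply: (cvg_ip ipP) cxd; apply: (cvg_comp x gradPhi cx).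
exact: gradP.2.
Qed.

Lemma lyapunov_abs_continuous a b : 0 < a -> abs_continuous_on a b lyapunov.
Proof.
move=> a0; have xda := velocity_abs_continuous b (ltW a0).
have ya := position_abs_continuous b a0.
have pwa e := @powR_abs_continuous a b e (ltW a0).
apply: abs_continuous_onD.
  by apply: abs_continuous_onM => //; exact: energy_abs_continuous.
apply: abs_continuous_onZ; apply: abs_continuous_onD.
  by apply: abs_continuous_onM => //; exact: (abs_continuous_on_ip ipP).
apply: abs_continuous_onZ; apply: abs_continuous_onM => //.
by apply: abs_continuous_onZ; exact: (abs_continuous_on_ip ipP).
Qed.

(** The cross weight is the geometric mean of the two quadratic weights times a decaying factor,
    which is why the cross term is eventually dominated. *)
Lemma weight_factor t : 0 <= t -> (1 + t) `^ (2 * nu - 1) = (1 + t) `^ nu *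
  (1 + t) `^ ((2 * nu - 1 - alpha) / 2) * (1 + t) `^ (- ((1 - alpha) / 2)).
Proof.
move=> t0; have s0 : 0 < 1 + t by rewrite ltr_pwDl.
rewrite (powR_mul_eq (e := nu + (2 * nu - 1 - alpha) / 2) s0)//.
by apply/esym; apply: powR_mul_eq => //; field.
Qed.

Lemma damping_factor t : 0 <= t ->
  ((1 + t) `^ (- ((1 - alpha) / 2))) ^+ 2 = (1 + t) `^ (alpha - 1).
Proof.
by move=> t0; rewrite expr2; apply: powR_mul_eq; [rewrite ltr_pwDl|field].
Qed.

Lemma lyapunovE t : 0 <= t -> lyapunov t =
  ((1 + t) `^ nu) ^+ 2 * (`|xd t| ^+ 2 / 2 + (Phi (x t) - Phi xstar))
  + (2 * nu + 1) * ((1 + t) `^ (2 * nu - 1) * ip (x t - xstar) (xd t) +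
    c * (((1 + t) `^ ((2 * nu - 1 - alpha) / 2)) ^+ 2 * (`|x t - xstar| ^+ 2 / 2))).
Proof.
move=> t0; have s0 : 0 < 1 + t by rewrite ltr_pwDl.
have -> : (1 + t) `^ nu ^+ 2 = (1 + t) `^ (2 * nu).
  by rewrite expr2; apply: powR_mul_eq => //; ring.
have -> : (1 + t) `^ ((2 * nu - 1 - alpha) / 2) ^+ 2 = (1 + t) `^ (2 * nu - 1 - alpha).
  by rewrite expr2; apply: powR_mul_eq => //; field.
rewrite /lyapunov /energy !(norm_sqrE ipP).
by rewrite (mulrC _ (2^-1)) (mulrC _ (2^-1)).
Qed.

Lemma lyapunov_ge t : 0 <= t -> (2 * nu + 1) * (1 + t) `^ (alpha - 1) <= c / 4 ->
  (1 + t) `^ (2 * nu) * energy t / 2 <= lyapunov t.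
Proof.
move=> t0; rewrite -damping_factor// => Kt.
have K0 : 0 < 2 * nu + 1 by have := nu_ge0; lra.
have := lyapunov_lower K0 (potential_ge0 t) (powR_ge0 _ _) (powR_ge0 _ _)
  (powR_ge0 _ _) Kt (weight_factor t0) (ip_le ipP _ _) (lyapunovE t0).
apply: le_trans; rewrite /energy -(norm_sqrE ipP) (mulrC 2^-1).
have -> : (1 + t) `^ nu ^+ 2 = (1 + t) `^ (2 * nu).
  by rewrite expr2; apply: powR_mul_eq; [rewrite ltr_pwDl|ring].
by rewrite lerDl divr_ge0// mulr_ge0 ?sqr_ge0// mulr_ge0// ltW.
Qed.

(** Substituting the equation cancels <grad Phi (x), x'> between the kinetic and potential parts. *)
Lemma is_derive_energy (t : R) acc : 0 < t -> is_derive t 1 xd acc ->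
  acc + (c / (1 + t) `^ alpha) *: xd t + gradPhi (x t) = g t ->
  is_derive t 1 energy
    (ip (g t) (xd t) - c / (1 + t) `^ alpha * ip (xd t) (xd t)).
Proof.
move=> t0 xda odet.
apply: (is_derive_eq (is_derive_add
  (is_derive_scale 2^-1 (is_derive_ip ipP xda xda))
  (is_derive_add (is_derive_comp_gradient gradP (xxd t0))
    (is_derive_cst (- Phi xstar) t (1 : R))))).
rewrite -odet !(ipDl ipP) (ipZl ipP) (ipC ipP (xd t) acc); lra.
Qed.

Lemma is_derive_lyapunov (t : R) acc : 0 < t -> is_derive t 1 xd acc ->
  acc + (c / (1 + t) `^ alpha) *: xd t + gradPhi (x t) = g t ->
  (2 * nu + 1) * (1 + t) `^ (alpha - 1) <= c / 4 ->
  exists2 dE, is_derive t 1 lyapunov dE &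
  dE <= - ((1 + t) `^ (2 * nu - 1) * energy t
           + c / 2 * ((1 + t) `^ (2 * nu - alpha) * ip (xd t) (xd t)))
    + ((2 + (2 * nu + 1) / c) * forcing t
       + (2 * (2 * nu + 1) + 2 / c) * (1 + t) `^ (- ((1 - alpha) / 2) - 1))
      * (1 + lyapunov t).
Proof.
move=> t0 xda odet Kt.
have s0 : 0 < 1 + t by rewrite ltr_wpDl.
have yd : is_derive t 1 (fun s => x s - xstar) (xd t).
  exact: is_derive_eq (is_deriveB (xxd t0) (is_derive_cst xstar t (1 : R))) (subr0 _).
have pwd e := is_derive_1Dpow e (ltW t0).
have dE := is_derive_add (is_derive_mul (pwd (2 * nu)) (is_derive_energy t0 xda odet))
  (is_derive_scale (2 * nu + 1) (is_derive_add
    (is_derive_mul (pwd (2 * nu - 1)) (is_derive_ip ipP yd xda))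
    (is_derive_scale c (is_derive_mul (pwd (2 * nu - 1 - alpha))
      (is_derive_scale 2^-1 (is_derive_ip ipP yd yd)))))).
pose s1 := (1 + t) `^ (2 * nu - 1); pose s2 := (1 + t) `^ (2 * nu - 1 - 1).
pose sa := (1 + t) `^ (2 * nu - alpha); pose sm := (1 + t) `^ (2 * nu - 1 - alpha).
pose gm := c / (1 + t) `^ alpha; pose y := x t - xstar.
pose X := c * ((2 * nu - 1 - alpha) * (1 + t) `^ (2 * nu - 1 - alpha - 1) *
    (2^-1 * ip y y)).
exists (2 * nu * s1 * energy t
   + (1 + t) `^ (2 * nu) * (ip (g t) (xd t) - gm * ip (xd t) (xd t))
   + (2 * nu + 1) * ((2 * nu - 1) * s2 * ip y (xd t)
      + s1 * (ip (xd t) (xd t) + ip y acc)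
      + (X + c * (sm * (2^-1 * (ip (xd t) y + ip y (xd t))))))).
  by apply: is_derive_eq dE _; rewrite /X -/y -/s1 -/s2 -/sm -/gm; ring.
rewrite forcingE ?(ltW t0)//.
have pwE a b e : a + b = e -> (1 + t) `^ a * (1 + t) `^ b = (1 + t) `^ e.
  exact: powR_mul_eq.
pose th := (1 + t) `^ (- ((1 - alpha) / 2)).
pose p := (1 + t) `^ nu.
pose w := (1 + t) `^ ((2 * nu - 1 - alpha) / 2).
have p2 : p ^+ 2 = (1 + t) `^ (2 * nu) by rewrite expr2; apply: pwE; ring.
have th2 : th ^+ 2 = (1 + t) `^ (alpha - 1) by exact: damping_factor (ltW t0).
have thE : (1 + t) `^ (- ((1 - alpha) / 2) - 1) = th / (1 + t).
  by rewrite -(pwE (- ((1 - alpha) / 2)) (-1))// powR_inv1// ltW.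
have s2E : s2 = s1 / (1 + t).
  by rewrite /s2 -(pwE (2 * nu - 1) (-1))// powR_inv1// ltW.
have s1E : s1 = p * w * th by exact: weight_factor (ltW t0).
have s1E' : s1 = th ^+ 2 * sa by rewrite th2; apply/esym/pwE; ring.
have g1 : (1 + t) `^ (2 * nu) * gm = c * sa.
  by rewrite /gm -powRN mulrCA (pwE _ _ (2 * nu - alpha)).
have g2 : s1 * gm = c * sm by rewrite /gm -powRN mulrCA (pwE _ _ (2 * nu - 1 - alpha)).
(* The upper bound on [nu] makes the exponent 2 nu - 1 - alpha nonpositive. *)
have X0 : X <= 0.
  rewrite /X mulr_ge0_le0 ?(ltW c0)// mulr_le0_ge0//.
    rewrite mulr_le0_ge0 ?powR_ge0//.
    by case/andP: nu_bounds => _; lra.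
  by rewrite mulr_ge0// -norm_sqrE// sqr_ge0.
have th01 : 0 <= th <= 1.
  rewrite powR_ge0/= -[leRHS](powRr0 (1 + t)) ler_powR//; first by rewrite lerDl ltW.
  by case/andP: alpha01 => _; lra.
have Vle : Phi (x t) - Phi xstar <= ip y (gradPhi (x t)).
  have := convex_gradient_le gradP (x t) xstar cvxPhi.
  by rewrite -[xstar - x t]opprB -/y (ipC ipP) -scaleN1r (ipZl ipP); lra.
have EE := lyapunovE (ltW t0).
have Kth : (2 * nu + 1) * th ^+ 2 <= c / 4 by rewrite th2.
have nu01 : 0 <= nu <= 1 by rewrite nu_ge0 nu_le1.
have t1 : 1 <= 1 + t by rewrite lerDl ltW.
have qle : `|ip y (xd t)| <= `|y| * `|xd t| by exact: ip_le.
have gxle : ip (g t) (xd t) <= `|g t| * `|xd t|.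
  by apply: le_trans (ler_norm _) _; exact: ip_le.
have grle : ip y (g t) <= `|y| * `|g t|.
  by apply: le_trans (ler_norm _) _; exact: ip_le.
have := lyapunov_derivative_le nu01 erefl c0 t1 (powR_ge0 _ _) (potential_ge0 t)
  (powR_ge0 _ _) (powR_ge0 _ _) th01 (normr_ge0 _) (normr_ge0 _) (normr_ge0 _) X0
  Kth s1E s1E' s2E qle gxle grle Vle EE.
rewrite (norm_sqrE ipP) p2 thE -/p -/s1 -/sa.
have accE : ip y acc = ip y (g t) - gm * ip y (xd t) - ip y (gradPhi (x t)).
  by rewrite -odet !(ipDr ipP) (ipZr ipP) -/gm; ring.
have e1 : (1 + t) `^ (2 * nu) * (ip (g t) (xd t) - gm * ip (xd t) (xd t)) =
    (1 + t) `^ (2 * nu) * ip (g t) (xd t) - c * sa * ip (xd t) (xd t).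
  by rewrite mulrBr mulrA g1.
have e2 : s1 * (ip (xd t) (xd t) + ip y acc) =
    s1 * (ip (xd t) (xd t) + ip y (g t) - ip y (gradPhi (x t)))
    - c * sm * ip y (xd t).
  by rewrite -g2 accE; ring.
rewrite e1 e2 (ipC ipP (xd t) y) /energy (mulrC (2^-1)) -/y.
lra.
Qed.

(** * Dissipated quantities, their primitives and uniform bounds *)

Definition weighted_kinetic (t : R) : R :=
  (1 + t) `^ (2 * nu - alpha) * ip (xd t) (xd t).

Definition weighted_energy (t : R) : R := (1 + t) `^ (2 * nu - 1) * energy t.

(** Starting at 0 is possible because [xd] is absolutely continuous up to 0, and a bound on it then
    bounds the integral of the theorem. *)
Definition kinetic_primitive (t : R) : R :=
  (\int[mu]_(s in `[0, t]) weighted_kinetic s)%R.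

(* The base point is 1 because [x] is not assumed to be continuous at 0. *)
Definition energy_primitive (t : R) : R :=
  (\int[mu]_(s in `[1, t]) weighted_energy s)%R.

Lemma weighted_kinetic_ge0 t : 0 <= weighted_kinetic t.
Proof. by rewrite mulr_ge0 ?powR_ge0// -norm_sqrE// sqr_ge0. Qed.

Lemma weighted_energy_ge0 t : 0 <= weighted_energy t.
Proof. by rewrite mulr_ge0 ?powR_ge0// energy_ge0. Qed.

Lemma kinetic_primitive_ge0 t : 0 <= kinetic_primitive t.
Proof. by apply: Rintegral_ge0 => s _; exact: weighted_kinetic_ge0. Qed.

Lemma energy_primitive_ge0 t : 0 <= energy_primitive t.
Proof. by apply: Rintegral_ge0 => s _; exact: weighted_energy_ge0. Qed.

Lemma weighted_kinetic_abs_continuous a b : 0 <= a ->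
  abs_continuous_on a b weighted_kinetic.
Proof.
move=> a0; have xda := velocity_abs_continuous b a0.
by apply: abs_continuous_onM; [exact: powR_abs_continuous|exact: (abs_continuous_on_ip ipP)].
Qed.

Lemma weighted_energy_abs_continuous a b : 0 < a ->
  abs_continuous_on a b weighted_energy.
Proof.
move=> a0; apply: abs_continuous_onM; last exact: energy_abs_continuous.
by apply: powR_abs_continuous; exact: ltW.
Qed.

Lemma weighted_kinetic_continuous t : 0 < t -> {for t, continuous weighted_kinetic}.
Proof.
move=> t0; apply: (abs_continuous_on_continuous (weighted_kinetic_abs_continuous (t + 1) (lexx 0))).
by rewrite t0 ltrDl ltr01.
Qed.

Lemma weighted_energy_continuous t : 1 < t -> {for t, continuous weighted_energy}.
Proof.
move=> t0; apply: (abs_continuous_on_continuous (weighted_energy_abs_continuous (t + 1) ltr01)).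
by rewrite t0 ltrDl ltr01.
Qed.

Lemma is_derive_kinetic_primitive (t : R) : 0 < t ->
  is_derive t 1 kinetic_primitive (weighted_kinetic t).
Proof.
move=> t0; apply: continuous_primitive_is_derive => //.
  exact: abs_continuous_on_within (weighted_kinetic_abs_continuous _ (lexx 0)).
exact: weighted_kinetic_continuous.
Qed.

Lemma is_derive_energy_primitive (t : R) : 1 < t ->
  is_derive t 1 energy_primitive (weighted_energy t).
Proof.
move=> t0; apply: continuous_primitive_is_derive => //.
  exact: abs_continuous_on_within (weighted_energy_abs_continuous _ ltr01).
exact: weighted_energy_continuous.
Qed.

Lemma kinetic_primitive_abs_continuous a b : 0 < a ->
  abs_continuous_on a b kinetic_primitive.
Proof.
move=> a0; apply: (derive_abs_continuous_on (df := weighted_kinetic)) => t /andP[at_ _].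
  by apply: is_derive_kinetic_primitive; exact: lt_le_trans at_.
by apply: weighted_kinetic_continuous; exact: lt_le_trans at_.
Qed.

Lemma energy_primitive_abs_continuous a b : 1 < a ->
  abs_continuous_on a b energy_primitive.
Proof.
move=> a0; apply: (derive_abs_continuous_on (df := weighted_energy)) => t /andP[at_ _].
  by apply: is_derive_energy_primitive; exact: lt_le_trans at_.
by apply: weighted_energy_continuous; exact: lt_le_trans at_.
Qed.

(** Merges two null sets: where the equation fails and where the primitive of the forcing is not
    differentiable. *)
Lemma ae_trajectory : {ae mu, forall t : R, 0 < t ->
  (exists2 acc, is_derive t 1 xd acc &
    acc + (c / (1 + t) `^ alpha) *: xd t + gradPhi (x t) = g t) /\
  is_derive t 1 forcing_primitive (forcing t)}.
Proof.
have := indefinite_integral_ae integrable_forcing.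
apply: (@filterS2 _ _ (ae_filter_ringOfSetsType mu) _ _ _ _ ode).
move=> t odet At t0; have [dxd xdE] := odet (ltW t0); split => //.
by exists ('D_1 xd t).
Qed.

Lemma threshold_exists : exists2 t0, 1 < t0 & forall t, t0 <= t ->
  (2 * nu + 1) * (1 + t) `^ (alpha - 1) <= c / 4.
Proof.
have K0 : 0 < 2 * nu + 1 by have := nu_ge0; lra.
have al : 0 < 1 - alpha by case/andP: alpha01; lra.
(* For K = 2 nu + 1, [u] solves K u^(alpha - 1) = c / 4. The 2 added below puts the threshold beyond
   1, where [energy_primitive] is differentiable. *)
pose u := (4 * (2 * nu + 1) / c) `^ (1 - alpha)^-1.
have u0 : 0 <= u by exact: powR_ge0.
exists (2 + u) => [|t ut]; first by lra.
have t0 : 0 < 1 + t by lra.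
have : u `^ (1 - alpha) <= (1 + t) `^ (1 - alpha).
  by apply: ge0_ler_powR; rewrite ?nnegrE; lra.
rewrite /u -powRrM mulVf ?gt_eqF// powRr1; last first.
  by rewrite divr_ge0 ?mulr_ge0 ?(ltW K0) ?(ltW c0).
rewrite -[alpha - 1]opprB powRN ler_pdivrMr// => h.
rewrite ler_pdivrMr ?powR_gt0//.
by move: h; lra.
Qed.

Lemma forcing_primitive_abs_continuous a b : abs_continuous_on a b forcing_primitive.
Proof. exact: (indefinite_integral_abs_continuous forcing_ge0 integrable_forcing). Qed.

(* Gronwall: with [Psi] a bounded primitive of the coefficient [psi] in the
   differential inequality of [is_derive_lyapunov], the quantity [Z] below is
   nonincreasing. *)
Lemma trajectory_bounds : exists t0 M : R, [/\ 1 < t0, 0 <= M &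
  forall t, t0 <= t -> [/\ (1 + t) `^ (2 * nu) * energy t <= M,
    kinetic_primitive t <= M & energy_primitive t <= M]].
Proof.
have [t0 t01 Kt] := threshold_exists; exists t0.
have t0_gt0 : 0 < t0 by exact: lt_trans ltr01 t01.
have K0 : 0 < 2 * nu + 1 by have := nu_ge0; lra.
pose be := (1 - alpha) / 2; have be0 : 0 < be by case/andP: alpha01; rewrite /be; lra.
pose C0 := 2 + (2 * nu + 1) / c; pose C1 := 2 * (2 * nu + 1) + 2 / c.
have C00 : 0 <= C0 by rewrite addr_ge0// divr_ge0 ?(ltW c0) ?(ltW K0).
have C10 : 0 <= C1.
  apply: addr_ge0; last exact: divr_ge0 (ltW c0).
  exact: mulr_ge0 (ltW K0).
pose psi t := C0 * forcing t + C1 * (1 + t) `^ (- be - 1).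
pose Psi t := C0 * forcing_primitive t + (- (C1 / be)) * (1 + t) `^ (- be).
pose Ainf := (\int[mu]_s forcing s)%R.
(* A uniform lower bound for exp(- Psi), since the power term of [Psi] is nonpositive. It lets the
   dissipation primitives enter [Z] with a constant factor. *)
pose kap := expR (- (C0 * Ainf)).
pose Z t := (1 + lyapunov t) * expR (-1 * Psi t)
  + kap * (energy_primitive t + c / 2 * kinetic_primitive t).
have kap0 : 0 < kap by exact: expR_gt0.
have kapP t : kap <= expR (-1 * Psi t).
  rewrite ler_expR mulN1r lerN2 /Psi.
  have h1 : C0 * forcing_primitive t <= C0 * Ainf.
    apply: ler_wpM2l => //.
    exact: (indefinite_integral_le forcing_ge0 integrable_forcing).
  have h2 : 0 <= (C1 / be) * (1 + t) `^ (- be).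
    by rewrite mulr_ge0 ?powR_ge0// divr_ge0// ltW.
  by rewrite mulNr; lra.
have lyap0 t : t0 <= t -> 0 <= lyapunov t.
  move=> tt0; apply: le_trans (lyapunov_ge _ (Kt t tt0)).
    by rewrite divr_ge0// mulr_ge0 ?powR_ge0// energy_ge0.
  exact: le_trans (ltW t0_gt0) tt0.
have ZT T : t0 <= T -> Z T <= Z t0.
  move=> t0T; apply: abs_continuous_on_le0_nincr => //.
    apply: abs_continuous_onD.
      apply: abs_continuous_onM.
        apply: abs_continuous_onD; first exact: abs_continuous_on_cst.
        exact: lyapunov_abs_continuous.
      apply: abs_continuous_on_expR; apply: abs_continuous_onZ.
      apply: abs_continuous_onD; apply: abs_continuous_onZ.
        exact: forcing_primitive_abs_continuous.
      by apply: powR_abs_continuous; exact: ltW.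
    apply: abs_continuous_onZ; apply: abs_continuous_onD.
      exact: energy_primitive_abs_continuous.
    by apply: abs_continuous_onZ; exact: kinetic_primitive_abs_continuous.
  apply: (@filterS _ _ (ae_filter_ringOfSetsType mu) _ _ _ ae_trajectory).
  move=> t + /andP[t0t _]; have t_gt0 : 0 < t by exact: lt_le_trans t0t.
  move=> /(_ t_gt0)[[acc xda odet] At].
  have [dE dEd dEle] := is_derive_lyapunov t_gt0 xda odet (Kt t t0t).
  have dPsi : is_derive t 1 (fun s => -1 * Psi s) (- psi t).
    apply: is_derive_eq (is_derive_scale (-1) (is_derive_add (is_derive_scale C0 At)
      (is_derive_scale (- (C1 / be)) (is_derive_1Dpow (- be) (ltW t_gt0))))) _.
    by rewrite /psi; field; rewrite gt_eqF.
  have dexp := @is_derive1_comp _ expR (fun s => -1 * Psi s) t _ _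
    (is_derive_expR (-1 * Psi t)) dPsi.
  have dZ := is_derive_add
    (is_derive_mul (is_derive_add (is_derive_cst (1 : R) t (1 : R)) dEd) dexp)
    (is_derive_scale kap (is_derive_add
      (is_derive_energy_primitive (lt_le_trans t01 t0t))
      (is_derive_scale (c / 2) (is_derive_kinetic_primitive t_gt0)))).
  split; first exact: (@ex_derive _ _ _ _ _ _ _ dZ).
  rewrite (@derive_val _ _ _ _ _ _ _ dZ) /= add0r.
  have := ler_wpM2r (expR_ge0 (-1 * Psi t)) dEle.
  have P0 : 0 <= weighted_energy t + c / 2 * weighted_kinetic t.
    by rewrite addr_ge0 ?weighted_energy_ge0// mulr_ge0 ?weighted_kinetic_ge0// divr_ge0// ltW.
  (* The dissipation multiplied by exp(- Psi) thus pays for the derivative of the second summand of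
     [Z]. *)
  have := ler_wpM2r P0 (kapP t).
  rewrite -/(weighted_energy t) -/(weighted_kinetic t) -/be -/C0 -/C1 -/(psi t).
  lra.
have Q0 t : 0 <= energy_primitive t + c / 2 * kinetic_primitive t.
  by rewrite addr_ge0 ?energy_primitive_ge0// mulr_ge0 ?kinetic_primitive_ge0// divr_ge0// ltW.
have z0 : 0 <= Z t0.
  rewrite addr_ge0// ?mulr_ge0 ?Q0 ?(ltW kap0) ?expR_ge0//.
  by rewrite addr_ge0 ?lyap0.
have zk0 : 0 <= Z t0 / kap by rewrite divr_ge0// ltW.
have zc0 : 0 <= 2 / c * (Z t0 / kap) by rewrite mulr_ge0// divr_ge0// ltW.
(* The factor 2 undoes the half in [lyapunov_ge]; 2 / c undoes the coefficient of
   [kinetic_primitive] in [Z]. *)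
exists (2 * (Z t0 / kap) + 2 / c * (Z t0 / kap)); split => //; first lra.
move=> t t0t; have t_ge0 : 0 <= t by exact: le_trans (ltW t0_gt0) t0t.
have e1 : (1 + lyapunov t) * kap <= (1 + lyapunov t) * expR (-1 * Psi t).
  by apply: ler_wpM2l => //; rewrite addr_ge0 ?lyap0.
have e2 : 0 <= (1 + lyapunov t) * kap.
  by rewrite mulr_ge0 ?(ltW kap0)// addr_ge0 ?lyap0.
have e3 : 0 <= kap * (energy_primitive t + c / 2 * kinetic_primitive t).
  by rewrite mulr_ge0 ?Q0 ?(ltW kap0).
have ZE := ZT t t0t.
have e4 : 1 + lyapunov t <= Z t0 / kap by rewrite ler_pdivlMr//; move: ZE; rewrite {1}/Z; lra.
have e5 : energy_primitive t + c / 2 * kinetic_primitive t <= Z t0 / kap.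
  by rewrite ler_pdivlMr// mulrC; move: ZE; rewrite {1}/Z; lra.
have le_k : 0 <= c / 2 * kinetic_primitive t.
  by rewrite mulr_ge0 ?kinetic_primitive_ge0// divr_ge0// ltW.
have le_e := energy_primitive_ge0 t.
split.
- by have := lyapunov_ge t_ge0 (Kt t t0t); move: e4 zc0; lra.
- have : c / 2 * kinetic_primitive t <= Z t0 / kap by lra.
  rewrite -ler_pdivlMl ?divr_gt0// invf_div; lra.
- by lra.
Qed.

(** * Decay of the energy and integrability of the velocity *)

Lemma velocity_le M t : 0 <= t -> (1 + t) `^ (2 * nu) * energy t <= M ->
  (1 + t) `^ nu * `|xd t| <= 1 + M.
Proof.
(* With y the weighted speed, y^2 <= 2 M and 2 y <= 1 + y^2 give a bound free of square roots. *)
move=> t0 FM; have := sqr_ge0 ((1 + t) `^ nu * `|xd t| - 1).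
have p2 : (1 + t) `^ nu ^+ 2 = (1 + t) `^ (2 * nu).
  by rewrite expr2; apply: powR_mul_eq; [rewrite ltr_pwDl|ring].
have : ((1 + t) `^ nu * `|xd t|) ^+ 2 <= 2 * M.
  rewrite exprMn p2 (norm_sqrE ipP).
  have := mulr_ge0 (powR_ge0 (1 + t) (2 * nu)) (potential_ge0 t).
  by move: FM; rewrite /energy; lra.
lra.
Qed.

(** Integrated form of F' <= 2 nu F / (1 + t) + (1 + M) forcing for F = (1 + t)^(2 nu) W:
    [weighted_energy] is F / (1 + t), the damping is dropped, and F minus the primitive of the
    right-hand side is nonincreasing. *)
Lemma weighted_energy_increment u M : 1 < u ->
  (forall t, u <= t -> (1 + t) `^ (2 * nu) * energy t <= M) ->
  forall s t, u <= s -> s <= t ->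
  (1 + t) `^ (2 * nu) * energy t - (1 + s) `^ (2 * nu) * energy s <=
  (2 * nu * energy_primitive t + (1 + M) * forcing_primitive t)
  - (2 * nu * energy_primitive s + (1 + M) * forcing_primitive s).
Proof.
move=> u1 FM s t us st.
have s1 : 1 < s by exact: lt_le_trans us.
pose G r := (1 + r) `^ (2 * nu) * energy r +
  -1 * (2 * nu * energy_primitive r + (1 + M) * forcing_primitive r).
suff : G t <= G s by rewrite /G; lra.
apply: abs_continuous_on_le0_nincr => //.
  apply: abs_continuous_onD.
    apply: abs_continuous_onM; first by apply: powR_abs_continuous; lra.
    by apply: energy_abs_continuous; exact: lt_trans s1.
  apply: abs_continuous_onZ; apply: abs_continuous_onD; apply: abs_continuous_onZ.
    exact: energy_primitive_abs_continuous.
  exact: forcing_primitive_abs_continuous.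
apply: (@filterS _ _ (ae_filter_ringOfSetsType mu) _ _ _ ae_trajectory).
move=> r + /andP[sr _]; have r1 : 1 < r by exact: lt_le_trans sr.
have r0 : 0 < r by exact: lt_trans r1.
move=> /(_ r0)[[acc xda odet] Ar].
have dG := is_derive_add
  (is_derive_mul (is_derive_1Dpow (2 * nu) (ltW r0)) (is_derive_energy r0 xda odet))
  (is_derive_scale (-1) (is_derive_add
    (is_derive_scale (2 * nu) (is_derive_energy_primitive r1))
    (is_derive_scale (1 + M) Ar))).
split; first exact: (@ex_derive _ _ _ _ _ _ _ dG).
rewrite (@derive_val _ _ _ _ _ _ _ dG) /weighted_energy forcingE ?(ltW r0)//.
have vle := velocity_le (ltW r0) (FM r (le_trans us sr)).
have p2 : (1 + r) `^ nu ^+ 2 = (1 + r) `^ (2 * nu).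
  by rewrite expr2; apply: powR_mul_eq; [rewrite ltr_pwDl ?(ltW r0)|ring].
have h1 : (1 + r) `^ (2 * nu) * ip (g r) (xd r) <= (1 + r) `^ nu * `|g r| * (1 + M).
  apply: (@le_trans _ _ ((1 + r) `^ nu * `|g r| * ((1 + r) `^ nu * `|xd r|))).
    rewrite -p2 (_ : _ * _ * (_ * _) = (1 + r) `^ nu ^+ 2 * (`|g r| * `|xd r|)); last by ring.
    rewrite ler_wpM2l ?sqr_ge0// (le_trans (ler_norm _))//; exact: ip_le.
  by rewrite ler_wpM2l// mulr_ge0 ?powR_ge0.
have h2 : 0 <= (1 + r) `^ (2 * nu) * (c / (1 + r) `^ alpha * ip (xd r) (xd r)).
  rewrite mulr_ge0 ?powR_ge0// mulr_ge0 ?divr_ge0 ?powR_ge0 ?(ltW c0)//.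
  by rewrite -norm_sqrE// sqr_ge0.
lra.
Qed.

(* The primitive of [F / (1 + t)] is bounded, where [F] is the weighted energy,
   whereas that of [e / (1 + t)] is not. *)
Lemma weighted_energy_small_frequently u M e : 1 < u -> 0 < e ->
  (forall t, u <= t -> energy_primitive t <= M) ->
  exists2 s, u <= s & (1 + s) `^ (2 * nu) * energy s <= e.
Proof.
move=> u1 e0 QM; apply: contrapT => /forallPNP h.
have Flarge s : u <= s -> e / (1 + s) <= weighted_energy s.
  move=> us; have s0 : 0 < 1 + s by lra.
  have /negP := h s us; rewrite -ltNge => /ltW Fs.
  rewrite ler_pdivrMr// /weighted_energy mulrAC -{2}(powRr1 (ltW s0)).
  by rewrite (powR_mul_eq (e := 2 * nu) s0)//; ring.
have M0 : 0 <= M by exact: le_trans (energy_primitive_ge0 u) (QM u (lexx u)).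
(* Chosen so that the integral of e / (1 + t) over [u, T] is at least M + 1, more than
   [energy_primitive] can gain. *)
pose T := u + expR (ln (1 + u) + (M + 1) / e).
have uT : u <= T by rewrite lerDl expR_ge0.
have incr : -1 * energy_primitive T + e * ln (1 + T) <=
    -1 * energy_primitive u + e * ln (1 + u).
  apply: (@derive_le0_nincr _ u T
    (fun t => -1 * energy_primitive t + e * ln (1 + t))
    (fun t => -1 * weighted_energy t + e * ((1 + t)^-1 * (0 + 1)))) => // t /andP[ut _].
    have t1 : 0 < 1 + t by lra.
    apply: is_derive_add.
      by apply: is_derive_scale; apply: is_derive_energy_primitive; exact: lt_le_trans ut.
    apply: is_derive_scale.
    have dt : is_derive t 1 (fun s : R => 1 + s) (0 + 1) by apply: is_derive_add.
    exact: (@is_derive1_comp _ (@ln R) (fun s => 1 + s) t _ _ (is_derive1_ln t1) dt).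
  by have := Flarge t ut; lra.
have lnT : ln (1 + u) + (M + 1) / e <= ln (1 + T).
  rewrite -[leLHS]expRK ler_ln ?posrE ?expR_gt0//.
    by rewrite /T; lra.
  by rewrite ltr_pwDl// (le_trans _ uT)//; lra.
have := ler_wpM2l (ltW e0) lnT.
have -> : e * (ln (1 + u) + (M + 1) / e) = e * ln (1 + u) + (M + 1).
  by field; rewrite gt_eqF.
move=> lnT'.
have := QM T uT; have := energy_primitive_ge0 u; lra.
Qed.

(** The increments of F = (1 + t)^(2 nu) W are bounded by those of [V], which is nondecreasing and
    bounded. Past a time where [V] gains at most e / 2, one instant with F <= e / 2 keeps F below e
    forever. *)
Lemma weighted_energy_cvg0 :
  (fun t => t `^ (2 * nu) * energy t) @ +oo_R --> 0.
Proof.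
have [t0 [M [t01 M0 bnd]]] := trajectory_bounds.
have FM t : t0 <= t -> (1 + t) `^ (2 * nu) * energy t <= M by move=> /bnd[].
have QM t : t0 <= t -> energy_primitive t <= M by move=> /bnd[].
have nu0 := nu_ge0.
pose V t := 2 * nu * energy_primitive t + (1 + M) * forcing_primitive t.
have Vnd s t : t0 <= s -> s <= t -> V s <= V t.
  move=> t0s st; rewrite /V lerD//; last first.
    rewrite ler_wpM2l ?addr_ge0//.
    exact: (indefinite_integral_nondecreasing forcing_ge0 integrable_forcing).
  rewrite ler_wpM2l ?mulr_ge0//.
  have : -1 * energy_primitive t <= -1 * energy_primitive s.
    apply: (@derive_le0_nincr _ s t (fun r => -1 * energy_primitive r)
      (fun r => -1 * weighted_energy r)) => // r /andP[sr _].
      apply: is_derive_scale; apply: is_derive_energy_primitive.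
      by apply: (lt_le_trans t01); exact: le_trans sr.
    by rewrite mulN1r oppr_le0 weighted_energy_ge0.
  by lra.
have VM t : t0 <= t -> V t <= 2 * nu * M + (1 + M) * (\int[mu]_s forcing s)%R.
  move=> t0t; rewrite /V lerD//; first by rewrite ler_wpM2l ?mulr_ge0 ?QM.
  rewrite ler_wpM2l ?addr_ge0//.
  exact: (indefinite_integral_le forcing_ge0 integrable_forcing).
apply/cvgrPdist_le => e e0; have e20 : 0 < e / 2 by rewrite divr_gt0.
have [u t0u uV] := nondecreasing_bounded_cauchy Vnd VM e20.
have u1 : 1 < u by exact: lt_le_trans t0u.
have [s us Fs] := weighted_energy_small_frequently u1 e20 (fun t ut => QM t (le_trans t0u ut)).
near=> t; have st : s <= t by near: t; apply: nbhs_pinfty_ge; exact: num_real.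
have t_ge0 : 0 <= t by apply: le_trans st; apply: le_trans us; lra.
rewrite sub0r normrN ger0_norm; last by rewrite mulr_ge0 ?powR_ge0// energy_ge0.
apply: (@le_trans _ _ ((1 + t) `^ (2 * nu) * energy t)).
  rewrite ler_wpM2r ?energy_ge0// ge0_ler_powR ?nnegrE ?mulr_ge0 ?addr_ge0//.
  by rewrite lerDr.
have := weighted_energy_increment u1 (fun t ut => FM t (le_trans t0u ut)) us st.
have := uV s t us st; rewrite /V; lra.
Unshelve. all: by end_near. Qed.

Lemma weighted_kinetic_integrable :
  (\int[mu]_(t in `[0%R, +oo[ : set R) (weighted_kinetic t)%:E < +oo)%E.
Proof.
have [t0 [M [t01 M0 bnd]]] := trajectory_bounds.
have t0_ge0 : 0 <= t0 by lra.
have wk_int T : mu.-integrable `[0, T] (EFin \o weighted_kinetic).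
  apply: continuous_compact_integrable; first exact: segment_compact.
  exact: abs_continuous_on_within (weighted_kinetic_abs_continuous _ (lexx 0)).
have mwk : measurable_fun (`[0%R, +oo[ : set R) weighted_kinetic.
  have -> : (`[0%R, +oo[ : set R)%classic = \bigcup_n `[0%R, n%:R]%classic.
    apply/seteqP; split => t /=; rewrite ?in_itv/= ?andbT.
      move=> ta; exists (Num.truncn t).+1 => //=.
      by rewrite in_itv/= ta/= ltW// truncnS_gt.
    by move=> [n _] /=; rewrite in_itv/= => /andP[].
  apply/measurable_fun_bigcup => // n.
  by have /integrableP[/measurable_EFinP] := wk_int n%:R.
apply: (@le_lt_trans _ _ M%:E); last exact: ltry.
apply: ge0_integral_itvcy_le => // [t _|T T0].
  exact: weighted_kinetic_ge0.
(* The bound on [kinetic_primitive] holds only from [t0] on, so a shorter interval is enlarged to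
   reach [t0]. *)
have maxT : T <= Num.max t0 T by rewrite le_max lexx orbT.
apply: (@le_trans _ _ (\int[mu]_(t in `[0%R, Num.max t0 T]) (weighted_kinetic t)%:E)%E).
  apply: ge0_subset_integral => //.
  - by have /integrableP[] := wk_int (Num.max t0 T).
  - by move=> t _; rewrite lee_fin weighted_kinetic_ge0.
  - by apply: subset_itvl; rewrite bnd_simp.
have t0max : t0 <= Num.max t0 T by rewrite le_max lexx.
have [_ + _] := bnd _ t0max; rewrite -lee_fin; apply: le_trans.
rewrite /kinetic_primitive /Rintegral fineK//.
exact: integrable_fin_num.
Qed.

End heavy_ball.

Unset Implicit Arguments. Set Strict Implicit.

Theorem theorem2 (R : realType) (H : completeNormedModType R)
  (ip : H -> H -> R) (Phi : H -> R) (gradPhi : H -> H) (xstar : H)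
  (c alpha nu : R) (g : R -> H) (x xd : R -> H) :
  is_inner_product ip ->
  convex_on_space Phi ->
  is_C1_gradient ip Phi gradPhi ->
  (forall y : H, Phi xstar <= Phi y) ->
  0 < c -> 0 <= alpha < 1 ->
  (* g in L^1(0,+oo;H) *)
  measurable_fun (`[0%R, +oo[ : set R) (fun t : R => `|g t|) ->
  (\int[lebesgue_measure]_(t in `[0%R, +oo[ : set R) (`|g t|)%:E < +oo)%E ->
  (* x in W^{2,1}_loc(0,+oo;H): x' = xd exists on (0,+oo), xd is absolutely
     continuous on every [0,T] *)
  (forall t : R, 0 < t -> is_derive t 1 x (xd t)) ->
  (forall T : R, 0 <= T -> abs_continuous_on 0 T xd) ->
  (* the differential equation, a.e. on [0,+oo) *)
  {ae lebesgue_measure, forall t : R, 0 <= t ->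
     derivable xd t 1 /\
     'D_1 xd t + (c / (1 + t) `^ alpha) *: xd t + gradPhi (x t) = g t} ->
  alpha <= nu <= (1 + alpha) / 2 ->
  (\int[lebesgue_measure]_(t in `[0%R, +oo[ : set R) ((1 + t) `^ nu * `|g t|)%:E
     < +oo)%E ->
  let W := fun t : R => 2^-1 * `|xd t| ^+ 2 + Phi (x t) - Phi xstar in
  (fun t : R => t `^ (2 * nu) * W t) @ +oo_R --> 0
  /\ (\int[lebesgue_measure]_(t in `[0%R, +oo[ : set R)
        ((1 + t) `^ (2 * nu - alpha) * `|xd t| ^+ 2)%:E < +oo)%E.
Proof.
move=> ipP cvxPhi gradP xstar_min c0 alpha01 mg _ xxd xd_ac ode nu_bounds int_g W.
have WE : W = energy ip Phi xstar x xd.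
  by apply/funext => t; rewrite /W /energy (norm_sqrE ipP) addrA.
split.
  rewrite WE; exact: (weighted_energy_cvg0 ipP cvxPhi gradP xstar_min c0 alpha01 mg xxd xd_ac
    ode nu_bounds int_g).
have := weighted_kinetic_integrable ipP cvxPhi gradP xstar_min c0 alpha01 mg xxd xd_ac
    ode nu_bounds int_g.
apply: le_lt_trans; rewrite le_eqVlt; apply/orP; left; apply/eqP.
by apply: eq_integral => t _; rewrite /weighted_kinetic (norm_sqrE ipP).
Qed.
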